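(* Let $\psi : M^2 \to \mathbb{L}^4$ be a spacelike immersion with $\psi(M^2)\subset\Lambda$ such that $\mathrm{II}_\eta$ is a Riemannian metric on $M^2$. Then $$2K^{\eta}=\frac{K^{2}}{\mathfrak{d}}+\mathrm{II}_{\eta}(L,L)-\frac{1}{4\mathfrak{d}^{2}}\,\mathrm{II}_{\eta}\big(\nabla^{\mathrm{II}_{\eta}}\mathfrak{d},\nabla^{\mathrm{II}_{\eta}}\mathfrak{d}\big)$$ on $M^2$, where $K$ is the Gauss curvature of the induced metric, $K^{\eta}$ is the Gauss curvature of $\mathrm{II}_\eta$ and $\mathfrak{d}=\det(A_\eta)$.
   Context: $\mathbb{L}^4$ is $\mathbb{R}^4$ with coordinates $(x_0,x_1,x_2,x_3)$ and the Lorentzian metric $\langle\cdot,\cdot\rangle=-dx_0^2+dx_1^2+dx_2^2+dx_3^2$. The future lightcone is $\Lambda=\{v\in\mathbb{L}^4:\langle v,v\rangle=0,\ v_0>0\}$. Surfaces $M^2$ are smooth connected 2-manifolds without boundary. An immersion $\psi:M^2\to\mathbb{L}^4$ is spacelike if the induced metric (also denoted $\langle\cdot,\cdot\rangle$) is Riemannian; $\nabla$ is its Levi-Civita connection. If $\psi(M^2)\subset\Lambda$, the position vector field $\psi$ is normal and lightlike, and $\eta$ denotes the unique normal vector field along $\psi$ with $\langle\eta,\eta\rangle=0$ and $\langle\psi,\eta\rangle=1$. The Weingarten operator $A_\eta$ is given by $\langle A_\eta X,Y\rangle=\langle \mathrm{II}(X,Y),\eta\rangle$, where $\mathrm{II}(X,Y)$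 is the normal component of $\overline\nabla_X Y$ (with $\overline\nabla$ the flat connection of $\mathbb{L}^4$). The $\eta$-second fundamental form is $\mathrm{II}_\eta(X,Y)=-\langle A_\eta X,Y\rangle$. When $\mathrm{II}_\eta$ is Riemannian, let $\nabla^{\mathrm{II}_\eta}$ denote its Levi-Civita connection; for a function $f$, $\nabla^{\mathrm{II}_\eta}f$ denotes the gradient of $f$ with respect to $\mathrm{II}_\eta$. The difference tensor is $L(X,Y)=\nabla^{\mathrm{II}_\eta}_XY-\nabla_XY$, and $\mathrm{II}_\eta(L,L)=\sum_{i,j=1}^{2}\mathrm{II}_\eta\big(L(w_i,w_j),L(w_i,w_j)\big)$ for any $\mathrm{II}_\eta$-orthonormal basis $\{w_1,w_2\}$ of the tangent plane. *)

(* Defs.v *)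
From HB Require Import structures.
From mathcomp Require Import all_boot all_order all_algebra.
From mathcomp Require Import all_classical all_reals all_analysis.
From mathcomp Require Import ring.

Set Implicit Arguments.
Unset Strict Implicit.
Unset Printing Implicit Defensive.

Import Order.TTheory GRing.Theory Num.Theory.
Import numFieldNormedType.Exports.

Local Open Scope classical_set_scope.
Local Open Scope ring_scope.

Section Calculus.
Context {R : realType} {V : normedModType R}.

Definition partial (i : 'I_2) (f : 'rV[R]_2 -> V) : 'rV[R]_2 -> V :=
  fun u => 'D_(delta_mx 0 i) f u.

Definition partials (s : seq 'I_2) (f : 'rV[R]_2 -> V) : 'rV[R]_2 -> V :=
  foldr partial f s.

(* C^oo on an open set: every iterated partial derivative is Frechet
   differentiable there. *)
Definition smooth_on (U : set 'rV[R]_2) (f : 'rV[R]_2 -> V) : Prop :=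
  forall s u, U u -> differentiable (partials s f) u.

End Calculus.

Record chart (R : realType) (M : topologicalType) := Chart {
  cdom : set M;
  cimg : set 'rV[R]_2;
  coords : M -> 'rV[R]_2;
  param : 'rV[R]_2 -> M;
  cdom_open : open cdom;
  cimg_open : open cimg;
  coords_img : forall p, cdom p -> cimg (coords p);
  param_dom : forall u, cimg u -> cdom (param u);
  coordsK : forall p, cdom p -> param (coords p) = p;
  paramK : forall u, cimg u -> coords (param u) = u;
  coords_cont : {within cdom, continuous coords};
  param_cont : {within cimg, continuous param}
}.

(* The atlas is not required to be maximal. *)
Record smooth_surface (R : realType) := SmoothSurface {
  carrier :> topologicalType;
  surface_hausdorff : hausdorff_space carrier;
  surface_second_countable : @second_countable carrier;
  surface_connected : connected [set: carrier];
  atlas : set (chart R carrier);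
  atlas_cover : forall p : carrier, exists2 c, atlas c & cdom c p;
  atlas_smooth : forall c c', atlas c -> atlas c' ->
    smooth_on (cimg c `&` param c @^-1` cdom c') (coords c' \o param c)
}.

(* Local Riemannian geometry in coordinates. At each point u, a tangent vector
   is the row of its components in the coordinate frame, and a bilinear form
   is its Gram matrix in that frame. *)
Section CoordinateGeometry.
Context {R : realType}.
Implicit Types (G : 'rV[R]_2 -> 'M[R]_2) (f : 'rV[R]_2 -> R).
Implicit Types (X Y Z : 'rV[R]_2 -> 'rV[R]_2) (u v w : 'rV[R]_2).

Definition bilin (B : 'M[R]_2) v w : R := (v *m B *m w^T) 0 0.

Definition riemannian_on (U : set 'rV[R]_2) G : Prop :=
  smooth_on U G /\
  forall u, U u ->
    (forall v w, bilin (G u) v w = bilin (G u) w v) /\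
    (forall v, v != 0 -> 0 < bilin (G u) v v).

Definition orthonormal_frame (B : 'M[R]_2) (w : 'I_2 -> 'rV[R]_2) : Prop :=
  forall i j, bilin B (w i) (w j) = (i == j)%:R.

Definition christoffel G u (k i j : 'I_2) : R :=
  2^-1 * \sum_l invmx (G u) k l *
    (partial i (fun z => G z j l) u + partial j (fun z => G z i l) u
     - partial l (fun z => G z i j) u).

(* The two properties characterizing the Levi-Civita connection. *)
Lemma christoffel_torsion_free G u k i j :
  (forall z, (G z)^T = G z) -> christoffel G u k i j = christoffel G u k j i.
Proof.
move=> Gsym.
have Gij : (fun z => G z i j) = (fun z => G z j i).
  by apply/funext => z; rewrite -[in LHS]Gsym mxE.
rewrite /christoffel Gij; congr (_ * _); apply: eq_bigr => l _.
by rewrite [X in X - _]addrC.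
Qed.

Lemma christoffel_metric G u k i j :
  (forall z, (G z)^T = G z) -> G u \in unitmx ->
  partial k (fun z => G z i j) u =
  \sum_l (christoffel G u l k i * G u l j + christoffel G u l k j * G u i l).
Proof.
move=> Gsym Gu.
have GE a b : (fun z => G z a b) = (fun z => G z b a).
  by apply/funext => z; rewrite -[in LHS]Gsym mxE.
have GuE a b : G u a b = G u b a by rewrite -[in LHS]Gsym mxE.
have lower (a b : 'I_2) : \sum_l christoffel G u l k a * G u l b =
    2^-1 * (partial k (fun z => G z a b) u + partial a (fun z => G z k b) u
            - partial b (fun z => G z k a) u).
  under eq_bigr do rewrite /christoffel -mulrA mulr_suml.
  rewrite -mulr_sumr exchange_big /=; congr (_ * _).
  have E m : \sum_l invmx (G u) l m * G u l b = (m == b)%:R.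
    have iG : (invmx (G u))^T = invmx (G u) by rewrite trmx_inv Gsym.
    have := congr1 (fun A : 'M[R]_2 => A m b) (mulVmx Gu).
    rewrite !mxE => <-; apply: eq_bigr => l _.
    by rewrite -[in LHS]iG mxE.
  rewrite (bigD1 b) //= [X in _ + X]big1 ?addr0 => [|m mb].
    under eq_bigr do rewrite mulrAC.
    by rewrite -mulr_suml E eqxx mul1r.
  under eq_bigr do rewrite mulrAC.
  by rewrite -mulr_suml E (negPf mb) mul0r.
rewrite big_split /=; under [X in _ = _ + X]eq_bigr do rewrite GuE.
rewrite !lower (GE j i) -mulrDr.
set a := partial k _ u; set b := partial i _ u; set c := partial j _ u.
have -> : a + b - c + (a + c - b) = a * 2.
  by ring.
by rewrite mulrCA mulVf ?mulr1 // pnatr_eq0.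
Qed.

(* Levi-Civita covariant derivative of Y along X. *)
Definition nabla G X Y : 'rV[R]_2 -> 'rV[R]_2 := fun u =>
  \sum_i X u 0 i *:
    (partial i Y u + \sum_j Y u 0 j *: \row_k christoffel G u k i j).

Definition coord_field (i : 'I_2) : 'rV[R]_2 -> 'rV[R]_2 :=
  fun=> delta_mx 0 i.

(* R(d0,d1)d1 = nabla_d0 nabla_d1 d1 - nabla_d1 nabla_d0 d1, since the
   coordinate fields commute; the sectional curvature is
   <R(d0,d1)d1, d0> / det G. *)
Definition gauss_curvature G u : R :=
  let d0 := coord_field 0 in let d1 := coord_field 1 in
  bilin (G u) (nabla G d0 (nabla G d1 d1) u - nabla G d1 (nabla G d0 d1) u)
    (d0 u) / \det (G u).

(* Determined by bilin (G u) (gradient G f u) v = df_u(v). *)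
Definition gradient G f u : 'rV[R]_2 :=
  (\row_i partial i f u) *m invmx (G u).

(* Value at u of nabla^H_X Y - nabla^G_X Y for X(u) = v and Y(u) = w; being
   tensorial, it may be computed with the constant-coefficient extensions of
   v and w. *)
Definition difference_tensor H G u v w : 'rV[R]_2 :=
  nabla H (fun=> v) (fun=> w) u - nabla G (fun=> v) (fun=> w) u.

End CoordinateGeometry.

Section Lorentz.
Context {R : realType}.
Implicit Types (a b : 'rV[R]_4) (X : 'rV[R]_2 -> 'rV[R]_4).

Definition lorentz a b : R :=
  - (a 0 0 * b 0 0) + \sum_(i < 3) a 0 (lift 0 i) * b 0 (lift 0 i).

Definition future_lightcone : set 'rV[R]_4 :=
  [set a | lorentz a a = 0 /\ 0 < a 0 0].

(* Below, X is the expression of an immersion in a chart. *)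

Definition induced_metric X u : 'M[R]_2 :=
  \matrix_(i, j) lorentz (partial i X u) (partial j X u).

Definition is_normal X u a : Prop := forall i, lorentz (partial i X u) a = 0.

Definition tangential X u a : 'rV[R]_4 :=
  \sum_i \sum_j (lorentz a (partial i X u) * invmx (induced_metric X u) i j)
    *: partial j X u.

Definition second_form X u (i j : 'I_2) : 'rV[R]_4 :=
  let a := partial i (partial j X) u in a - tangential X u a.

(* The normal vector eta with <eta, eta> = 0 and <X, eta> = 1; it is unique
   when X is a spacelike immersion into the lightcone. *)
Definition eta X u : 'rV[R]_4 :=
  xget 0 [set a | [/\ is_normal X u a, lorentz a a = 0 & lorentz (X u) a = 1]].

(* Row i holds the components of A_eta(d_i): the defining relation
   <A_eta d_i, d_j> = <II(d_i, d_j), eta> reads A *m g = B. *)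
Definition weingarten X u : 'M[R]_2 :=
  (\matrix_(i, j) lorentz (second_form X u i j) (eta X u))
    *m invmx (induced_metric X u).

Definition II_eta X u : 'M[R]_2 := - (weingarten X u *m induced_metric X u).

End Lorentz.

Section Immersions.
Context {R : realType} (M : smooth_surface R).
Implicit Type psi : M -> 'rV[R]_4.

Definition local_expr psi (c : chart R M) : 'rV[R]_2 -> 'rV[R]_4 :=
  psi \o param c.

Definition spacelike_immersion psi : Prop :=
  forall c, atlas c ->
    [/\ smooth_on (cimg c) (local_expr psi c),
        (forall u, cimg c u -> injective ('d (local_expr psi c) u)) &
        riemannian_on (cimg c) (induced_metric (local_expr psi c))].

Definition II_eta_riemannian psi : Prop :=
  forall c, atlas c -> riemannian_on (cimg c) (II_eta (local_expr psi c)).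

End Immersions.

(* Main.v *)
Require Import Defs.
From mathcomp Require Import all_boot all_order all_algebra.
From mathcomp Require Import all_classical all_reals all_analysis.
From mathcomp Require Import ring lra.
Set Implicit Arguments.
Unset Strict Implicit.
Unset Printing Implicit Defensive.
Import Order.TTheory GRing.Theory Num.Theory.
Import numFieldNormedType.Exports.

Local Open Scope classical_set_scope.
Local Open Scope ring_scope.

(** In a chart write [X] for the immersion, [g] for the induced metric and [h] for
    [II_eta]. The formula holds because [h] is a Codazzi tensor of [g], and because the
    Gauss curvature [K] of [g] is the [g]-trace of [h].

    Differentiating [<X,X> = 0] shows that [X_i] is orthogonal to [X] and that
    [<X_ij,X> = - g_ij], so in the frame [X_0, X_1, X, eta] the second derivatives are
    [X_ij = sum_l Gamma^l_ij X_l - h_ij X - g_ij eta] ([gauss_formula]). The inner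
    products of these vectors give the Gauss equation
    [K det g = g_11 h_00 - 2 g_01 h_01 + g_00 h_11] ([gauss_equation]). The derivatives
    of [eta] are tangent, with [<X_l,eta_k> = h_kl], so differentiating
    [h_ij = - <X_ij,eta>] and using the symmetry of third derivatives makes the
    [g]-covariant derivative of [h] totally symmetric ([II_eta_codazzi]).

    The rest is intrinsic and concerns any metric [h] that is Codazzi with respect to a
    metric [g] ([codazzi_pair_curvature]). Both Levi-Civita connections are torsion free
    and [h (L (X,Y), Z)] is half the covariant derivative of [h], so it is a symmetric
    cubic form. Comparing the two curvature tensors, the terms in the derivative of [L]
    reduce to an action of the curvature of [g] on [h], which leaves
    [2 K_h = K_g tr_h g + 2 (|L_01|^2 - <L_00,L_11>)] in an [h]-orthonormal frame
    ([codazzi_gauss_curvature], [riemann_contract]). Now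
    [2 (|L_01|^2 - <L_00,L_11>) = |L|^2 - |L_00 + L_11|^2], and the symmetry of the cubic
    form identifies [L_00 + L_11] with the [h]-gradient of [d] divided by [2 d], where
    [d = det h / det g], since the logarithmic derivative of a metric determinant is twice
    the trace of its Christoffel symbols. Finally [det A_eta = det (- h g^-1) = d] and
    [tr_h g = tr_g h / d = K / d]. *)

(** * Symmetry of second derivatives *)

Section Young.
Context {R : realType} {V : normedModType R}.
Implicit Types (f : V -> R) (a u v w : V).

Lemma is_derive_line f a v (s : R) : derivable f (a + s *: v) v ->
  is_derive s 1 (fun r : R => f (a + r *: v)) ('D_v f (a + s *: v)).
Proof.
move=> df.
have E : (fun h : R => h^-1 *: (((fun r : R => f (a + r *: v)) \o shift s) (h *: 1)
      - f (a + s *: v))) =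
    (fun h => h^-1 *: ((f \o shift (a + s *: v)) (h *: v) - f (a + s *: v))).
  apply/funext => h /=; congr (_ *: (f _ - _)).
  by rewrite [h *: 1]mulr1 scalerDl addrCA.
by split; rewrite ?/derivable ?/derive E.
Qed.

Lemma differentiable_expansion f u : differentiable f u -> forall e, 0 < e ->
  exists2 r, 0 < r & forall k, `|k| < r ->
    `|f (u + k) - f u - 'd f u k| <= e * `|k|.
Proof.
move=> df e e0; have /eqaddoP /(_ _ e0) := diff_locally df.
move=> /nbhs_ballP[r /= r0 H]; exists r => // k kr.
have := H k; rewrite -ball_normE /= sub0r normrN => /(_ kr).
by rewrite -![(_ + _ : _ -> _) _]/(_ + _) -![(- _ : _ -> _) _]/(- _) /= opprD addrA
  [k + u]addrC.
Qed.

(** The mean value theorem along [v] turns the second difference into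
    [t] times an increment of [D_v f] over [t w]; differentiability of [D_v f] at the
    single point [u] then evaluates that increment up to [o(t)]. *)
Lemma second_difference f u v w :
  (\forall x \near u, differentiable f x) -> differentiable ('D_v f) u ->
  forall e, 0 < e -> \forall t \near 0^'+,
  `|f (u + t *: v + t *: w) - f (u + t *: v) - f (u + t *: w) + f u
    - t ^+ 2 * 'D_w ('D_v f) u| <= e * t ^+ 2.
Proof.
move=> /nbhs_ballP[r0 /= r0_gt0 fdiff] gdiff e e0.
pose C := `|v| + `|w| + 1.
have C0 : 0 < C by rewrite /C; have := normr_ge0 v; have := normr_ge0 w; lra.
have e'0 : 0 < e / (2 * C) by rewrite divr_gt0 // mulr_gt0.
have [r1 r1_gt0 gexp] := differentiable_expansion gdiff e'0.
have dE z : differentiable f z -> forall z', derivable f z z'.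
  by move=> dz z'; apply: diff_derivable.
near=> t.
have t0 : 0 < t by near: t; exact: nbhs_right_gt.
have tC0 : t * C < r0.
  rewrite -ltr_pdivlMr //; near: t; apply: nbhs_right_lt; exact: divr_gt0.
have tC1 : t * C < r1.
  rewrite -ltr_pdivlMr //; near: t; apply: nbhs_right_lt; exact: divr_gt0.
have small b c : 0 <= b <= t -> 0 <= c <= t -> `|b *: v + c *: w| <= t * C.
  move=> /andP[b0 bt] /andP[c0 ct]; rewrite (le_trans (ler_normD _ _)) // !normrZ.
  rewrite !ger0_norm // /C; have := normr_ge0 v; have := normr_ge0 w.
  move=> w0 v0; have := ler_wpM2r v0 bt; have := ler_wpM2r w0 ct; nra.
have fd b c : 0 <= b <= t -> 0 <= c <= t ->
    differentiable f (u + c *: w + b *: v).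
  move=> hb hc; apply: fdiff; rewrite -ball_normE /= -addrA opprD addNKr normrN.
  by rewrite addrC; apply: le_lt_trans (small _ _ hb hc) tC0.
have tt : 0 <= t <= t by rewrite lexx ltW.
have zt : 0 <= (0 : R) <= t by rewrite lexx ltW.
(* phi t - phi 0 is the second difference, and phi is differentiable on [0, t]. *)
pose phi (s : R) := f (u + t *: w + s *: v) - f (u + s *: v).
have phi_d s : s \in `[0, t]%R -> is_derive s 1 phi
    ('D_v f (u + t *: w + s *: v) - 'D_v f (u + s *: v)).
  rewrite in_itv /= => hs; apply: is_deriveB; apply: is_derive_line; apply: dE.
    exact: fd.
  by have := fd _ _ hs zt; rewrite scale0r addr0.
have [|c cI] := @MVT R phi _ 0 t t0 (fun s hs => phi_d s (subset_itv_oo_cc hs)).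
  apply: derivable_within_continuous => s hs; exact: (@ex_derive _ _ _ _ _ _ _ (phi_d s hs)).
rewrite subr0 /phi scale0r !addr0 => Dphi.
have hc : 0 <= c <= t by have := subset_itv_oo_cc cI; rewrite in_itv.
have -> : f (u + t *: v + t *: w) - f (u + t *: v) - f (u + t *: w) + f u =
    ('D_v f (u + t *: w + c *: v) - 'D_v f (u + c *: v)) * t.
  by rewrite -Dphi [u + t *: v + _]addrAC; ring.
have g1 := gexp _ (le_lt_trans (small _ _ hc tt) tC1).
have s2 := small _ _ hc zt; rewrite scale0r addr0 in s2.
have g2 := gexp _ (le_lt_trans s2 tC1).
have {}g1 := le_trans g1 (ler_wpM2l (ltW e'0) (small _ _ hc tt)).
have {}g2 := le_trans g2 (ler_wpM2l (ltW e'0) s2).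
rewrite (deriveE _ gdiff); rewrite raddfD /= in g1.
have dw : 'd ('D_v f) u (t *: w) = t * 'd ('D_v f) u w by rewrite linearZ.
rewrite dw addrA [u + c *: v + _]addrAC in g1.
have eC : e / (2 * C) * (t * C) = e * t / 2.
  by field; rewrite gt_eqF.
rewrite eC in g1 g2.
move: g1 g2; set A := 'D_v f (_ + c *: v); set B := 'D_v f (u + c *: v).
set D0 := 'D_v f u; set dv := 'd _ u (c *: v); set D := 'd _ u w => g1 g2.
have -> : (A - B) * t - t ^+ 2 * D =
  t * ((A - D0 - (dv + t * D)) - (B - D0 - dv)) by ring.
rewrite normrM (gtr0_norm t0).
have -> : e * t ^+ 2 = t * (e * t / 2 + e * t / 2) by field.
rewrite ler_pM2l // (le_trans (ler_normB _ _)) // lerD //.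
Unshelve. all: by end_near. Qed.

(** The second difference of [f] is symmetric in [v] and [w], and by
    [second_difference] it is asymptotic to [t^2] times either mixed derivative. *)
Lemma deriveC f u v w :
  (\forall x \near u, differentiable f x) ->
  differentiable ('D_v f) u -> differentiable ('D_w f) u ->
  'D_w ('D_v f) u = 'D_v ('D_w f) u.
Proof.
move=> fd dv dw; apply/eqP; rewrite -subr_eq0 -normr_eq0 eq_le normr_ge0 andbT.
apply/ler_addgt0Pl => e e0; rewrite addr0.
have e2 : 0 < e / 2 by rewrite divr_gt0.
have pos : \forall t \near (0 : R)^'+, 0 < t by exact: nbhs_right_gt.
have [t [[H1 H2] t0]] := filter_ex
  (filterI (filterI (second_difference w fd dv e2) (second_difference v fd dw e2)) pos).
have t2 : 0 < t ^+ 2 by rewrite exprn_gt0.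
rewrite -(ler_pM2l t2) -[X in X * `|_|](gtr0_norm t2) -normrM.
rewrite [u + t *: w + _]addrAC in H2.
move: H1 H2; set F := f (_ + _ + _); set Dv := 'D_w _ u; set Dw := 'D_v _ u => H1 H2.
have -> : t ^+ 2 * (Dv - Dw) =
  (F - f (u + t *: w) - f (u + t *: v) + f u - t ^+ 2 * Dw) -
  (F - f (u + t *: v) - f (u + t *: w) + f u - t ^+ 2 * Dv) by ring.
apply: (le_trans (ler_normB _ _)).
have -> : t ^+ 2 * e = e / 2 * t ^+ 2 + e / 2 * t ^+ 2 by field.
exact (lerD H2 H1).
Qed.

End Young.

(** * Calculus of partial derivatives *)

Lemma sum_ord2 (V : nmodType) (F : 'I_2 -> V) : \sum_i F i = F 0 + F 1.
Proof. by rewrite big_ord_recl big_ord1; congr (_ + F _); apply: val_inj. Qed.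

Lemma forall_ord2 (P : 'I_2 -> Prop) : P 0 -> P 1 -> forall i, P i.
Proof.
move=> P0 P1 [[|[|//]] hi]; [have -> : Ordinal hi = 0 | have -> : Ordinal hi = 1];
  by [apply: val_inj | ].
Qed.

Lemma differentiable_eq_on (R : realType) (W V : normedModType R) (U : set W)
    (f g : W -> V) u :
  open U -> (forall z, U z -> f z = g z) -> U u ->
  differentiable f u -> differentiable g u.
Proof.
move=> oU fg Uu df; have [dc dfE] := (diff_locallyP _ _).1 df.
have nU : \forall h \near (0 : W), f (h + u) = g (h + u).
  have : \forall z \near u, f z = g z.
    by near=> z; apply: fg; near: z; exact: open_nbhs_nbhs.
  by rewrite (near_shift 0) /= subr0.
have gE : g \o shift u = cst (g u) + 'd f u +o_ 0 id.
  apply/eqaddoP => e e0; have /eqaddoP /(_ e e0) := dfE.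
  apply: filterS2 nU => h fgh.
  rewrite -![(_ + _ : _ -> _) _]/(_ + _) -![(- _ : _ -> _) _]/(- _) /=.
  by rewrite -![(_ + _ : _ -> _) _]/(_ + _) /= fgh (fg u Uu).
have dE := diff_unique dc gE.
by apply/diff_locallyP; rewrite dE.
Unshelve. all: by end_near. Qed.

Section Partial.
Context {R : realType}.
Implicit Types (U : set 'rV[R]_2) (f g : 'rV[R]_2 -> R) (u : 'rV[R]_2) (i : 'I_2).

Lemma partialD (V : normedModType R) i (f g : 'rV[R]_2 -> V) u :
  differentiable f u -> differentiable g u ->
  partial i (fun z => f z + g z) u = partial i f u + partial i g u.
Proof. by move=> df dg; rewrite /partial deriveD //; apply: diff_derivable. Qed.

Lemma partialN (V : normedModType R) i (f : 'rV[R]_2 -> V) u : differentiable f u ->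
  partial i (fun z => - f z) u = - partial i f u.
Proof. by move=> df; rewrite /partial deriveN //; apply: diff_derivable. Qed.

Lemma partialM i f g u : differentiable f u -> differentiable g u ->
  partial i (fun z => f z * g z) u = partial i f u * g u + f u * partial i g u.
Proof.
move=> df dg; rewrite /partial deriveM; try exact: diff_derivable.
by rewrite addrC; congr (_ + _); exact: mulrC.
Qed.

Lemma partialMDM i (f g p q : 'rV[R]_2 -> R) u :
  differentiable f u -> differentiable g u -> differentiable p u -> differentiable q u ->
  partial i (fun z => f z * g z + p z * q z) u =
  (partial i f u * g u + f u * partial i g u) + (partial i p u * q u + p u * partial i q u).
Proof.
by move=> df dg dp dq; rewrite partialD ?(partialM _ df dg) ?(partialM _ dp dq) //;
  apply: differentiableM.
Qed.

Lemma partialV i f u : f u != 0 -> differentiable f u ->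
  partial i (fun z => (f z)^-1) u = - (f u) ^- 2 * partial i f u.
Proof. by move=> f0 df; rewrite /partial deriveV //; apply: diff_derivable. Qed.

Lemma partial_cst (V : normedModType R) i (a : V) u : partial i (fun=> a) u = 0.
Proof. exact: derive_cst. Qed.

Lemma partial_eq_on (V : normedModType R) U (f g : 'rV[R]_2 -> V) i u :
  open U -> (forall z, U z -> f z = g z) -> U u ->
  partial i f u = partial i g u.
Proof.
move=> oU fg Uu; apply: near_eq_derive.
by near=> z; apply: fg; near: z; exact: open_nbhs_nbhs.
Unshelve. all: by end_near. Qed.

Lemma smooth_differentiable (V : normedModType R) U (f : 'rV[R]_2 -> V) u :
  smooth_on U f -> U u -> differentiable f u.
Proof. by move=> sf Uu; have := sf [::] u Uu. Qed.

Lemma smooth_partial (V : normedModType R) U (f : 'rV[R]_2 -> V) i :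
  smooth_on U f -> smooth_on U (partial i f).
Proof. by move=> sf s u Uu; have := sf (rcons s i) u Uu; rewrite /partials foldr_rcons. Qed.

Section Entries.
Context {m n : nat}.
Implicit Types M : 'rV[R]_2 -> 'M[R]_(m, n).

Lemma partial_entry M i a b u : differentiable M u ->
  partial i (fun z => M z a b) u = partial i M u a b.
Proof. by move=> dM; rewrite /partial derive_mx ?mxE //; apply: diff_derivable. Qed.

Lemma differentiable_entry M a b u : differentiable M u ->
  differentiable (fun z => M z a b) u.
Proof.
by move=> dM; apply: (@differentiable_comp _ _ _ _ M (fun N : 'M[R]_(m, n) => N a b));
  last exact: differentiable_coord.
Qed.

Lemma differentiable_row p (f : 'rV[R]_2 -> 'rV[R]_p) u :
  (forall k, differentiable (fun z => f z 0 k) u) -> differentiable f u.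
Proof.
move=> df; rewrite (_ : f = \sum_k (fun z => f z 0 k *: delta_mx 0 k)).
  by apply: differentiable_sum => k; apply: differentiableZl.
by apply/funext => z; rewrite fct_sumE {1}[f z]row_sum_delta.
Qed.

Lemma partials_entry U M a b s u : open U -> smooth_on U M -> U u ->
  partials s (fun z => M z a b) u = partials s M u a b.
Proof.
move=> oU sM; elim: s u => [//|i s IH] u Uu /=.
rewrite -partial_entry; last exact: sM.
exact: (partial_eq_on (U := U)).
Qed.

Lemma smooth_entry U M a b : open U -> smooth_on U M ->
  smooth_on U (fun z => M z a b).
Proof.
move=> oU sM s u Uu.
apply: (differentiable_eq_on (U := U) (f := fun z => partials s M z a b)) => //.
  by move=> z Uz; rewrite (partials_entry _ _ _ oU sM).
exact/differentiable_entry/sM.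
Qed.

End Entries.

Lemma partialC U f i j u : open U -> smooth_on U f -> U u ->
  partial i (partial j f) u = partial j (partial i f) u.
Proof.
move=> oU sf Uu; apply: deriveC.
- near=> z; apply: (smooth_differentiable (U := U)) => //.
  by near: z; exact: open_nbhs_nbhs.
- exact: (sf [:: j]).
- exact: (sf [:: i]).
Unshelve. all: by end_near. Qed.

Lemma partialC_mx m n U (M : 'rV[R]_2 -> 'M[R]_(m, n)) i j u :
  open U -> smooth_on U M -> U u ->
  partial i (partial j M) u = partial j (partial i M) u.
Proof.
move=> oU sM Uu; apply/matrixP => a b.
have E k l : partial k (partial l M) u a b =
    partial k (partial l (fun z => M z a b)) u.
  rewrite -partial_entry; last exact: (sM [:: l]).
  apply: (partial_eq_on (U := U)) => // z Uz.
  by rewrite partial_entry //; apply: smooth_differentiable Uz.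
have C := partialC i j oU (smooth_entry a b oU sM) Uu.
exact (etrans (E i j) (etrans C (esym (E j i)))).
Qed.
End Partial.

(** * Metrics in coordinates *)

Section Metric.
Context {R : realType}.
(* Keeps unification from comparing two derivatives by unfolding them to limits. *)
#[local] Opaque partial.
Implicit Types (U : set 'rV[R]_2) (G H : 'rV[R]_2 -> 'M[R]_2) (u v w : 'rV[R]_2).
Implicit Types (i j k l m : 'I_2).

Lemma bilin_delta (B : 'M[R]_2) i j : bilin B (delta_mx 0 i) (delta_mx 0 j) = B i j.
Proof. by rewrite /bilin -rowE trmx_delta -colE !mxE. Qed.

Lemma bilinE (B : 'M[R]_2) v w :
  bilin B v w = v 0 0 * B 0 0 * w 0 0 + v 0 0 * B 0 1 * w 0 1
              + v 0 1 * B 1 0 * w 0 0 + v 0 1 * B 1 1 * w 0 1.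
Proof. by rewrite /bilin !mxE sum_ord2 !mxE !sum_ord2; ring. Qed.

Lemma det2 (A : 'M[R]_2) : \det A = A 0 0 * A 1 1 - A 0 1 * A 1 0.
Proof.
rewrite (expand_det_row _ 0) sum_ord2 /cofactor !det_mx11 !mxE /=.
have -> : lift 0 0 = 1 :> 'I_2 by apply: val_inj.
have -> : lift 1 0 = 0 :> 'I_2 by apply: val_inj.
by rewrite expr0 expr1; ring.
Qed.

Lemma riemannian_sym U G u i j : riemannian_on U G -> U u -> G u i j = G u j i.
Proof. by move=> [_ /(_ u)] HG Uu; have [sG _] := HG Uu; rewrite -!bilin_delta. Qed.

Lemma riemannian_diag U G u i : riemannian_on U G -> U u -> 0 < G u i i.
Proof.
move=> [_ /(_ u) pos] /pos[_ {}pos]; rewrite -bilin_delta; apply: pos.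
by apply/eqP => /matrixP /(_ 0 i)/eqP; rewrite !mxE !eqxx oner_eq0.
Qed.

Lemma riemannian_det U G u : riemannian_on U G -> U u -> 0 < \det (G u).
Proof.
move=> gG Uu; have [_ /(_ u Uu)[_ pos]] := gG.
have sG := riemannian_sym 1 0 gG Uu; have g0 := riemannian_diag 0 gG Uu.
(* The G-orthogonal complement of the first coordinate vector. *)
pose v : 'rV[R]_2 := \row_j (if j == 0 then - G u 0 1 else G u 0 0).
have v0 : v != 0.
  apply/eqP => /matrixP /(_ 0 1)/eqP; rewrite !mxE /=; apply/negP; exact: lt0r_neq0.
have := pos _ v0; rewrite bilinE !mxE /= sG det2 sG => D.
rewrite -(pmulr_rgt0 _ g0); move: D; congr (0 < _); ring.
Qed.

Lemma riemannian_unit U G u : riemannian_on U G -> U u -> G u \in unitmx.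
Proof.
by move=> gG Uu; rewrite unitmxE unitfE; apply/lt0r_neq0/(riemannian_det gG Uu).
Qed.

Lemma differentiable_inverse U G u i j : open U -> riemannian_on U G -> U u ->
  differentiable (fun z => invmx (G z) i j) u.
Proof.
move=> oU gG Uu.
have dG a b : differentiable (fun z => G z a b) u.
  by apply: differentiable_entry; apply: smooth_differentiable Uu; case: gG.
apply: (differentiable_eq_on (U := U)
  (f := fun z => (\det (G z))^-1 * cofactor (G z) j i)) => //.
  by move=> z Uz; rewrite /invmx (riemannian_unit gG Uz) !mxE.
apply: differentiableM.
  apply: differentiableV; last by apply/lt0r_neq0/(riemannian_det gG Uu).
  rewrite (_ : (fun z => _) = fun z => G z 0 0 * G z 1 1 - G z 0 1 * G z 1 0).
    by apply: differentiableB; apply: differentiableM.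
  by apply/funext => z; rewrite det2.
rewrite (_ : (fun z => _) = fun z => (-1) ^+ (j + i) * G z (lift j 0) (lift i 0)).
  by apply: differentiableM => //; exact: differentiable_cst.
by apply/funext => z; rewrite /cofactor det_mx11 !mxE.
Qed.

(** Christoffel symbols of the first kind. *)
Definition christoffel1 G u i j l : R :=
  2^-1 * (partial i (fun z => G z j l) u + partial j (fun z => G z i l) u
          - partial l (fun z => G z i j) u).

(** The Koszul computation: an expression that is symmetric in its
    first two indices and splits the derivatives of the metric is determined by them. For an immersed surface
    it applies to [S a b c = <X_ab, X_c>]. *)
Lemma christoffel1_koszul G u (S : 'I_2 -> 'I_2 -> 'I_2 -> R) :
  (forall a b c, partial a (fun z => G z b c) u = S a b c + S a c b) ->
  (forall a b c, S a b c = S b a c) ->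
  forall i j l, christoffel1 G u i j l = S i j l.
Proof.
move=> dG sS i j l; rewrite /christoffel1 !dG (sS j i l) (sS l i j) (sS l j i).
by field.
Qed.

Lemma christoffel_lower U G u i j k : riemannian_on U G -> U u ->
  \sum_l christoffel G u l i j * G u l k = christoffel1 G u i j k.
Proof.
move=> gG Uu; have uG := riemannian_unit gG Uu.
have E m : \sum_l invmx (G u) l m * G u l k = (k == m)%:R.
  have := congr1 (fun A : 'M[R]_2 => A k m) (mulmxV uG).
  rewrite !mxE => <-; apply: eq_bigr => l _.
  by rewrite mulrC (riemannian_sym _ _ gG Uu).
under eq_bigr do rewrite /christoffel -mulrA mulr_suml.
rewrite -mulr_sumr exchange_big /=; congr (_ * _).
rewrite (bigD1 k) //= [X in _ + X]big1 ?addr0 => [|m mk].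
  under eq_bigr do rewrite mulrAC.
  by rewrite -mulr_suml E eqxx mul1r.
under eq_bigr do rewrite mulrAC.
by rewrite -mulr_suml E eq_sym (negPf mk) mul0r.
Qed.

Lemma metric_smooth U G i j : open U -> riemannian_on U G ->
  smooth_on U (fun z => G z i j).
Proof. by move=> oU [sG _]; apply: smooth_entry. Qed.

Lemma partial_metric_sym U G i j k u : open U -> riemannian_on U G -> U u ->
  partial k (fun z => G z i j) u = partial k (fun z => G z j i) u.
Proof.
move=> oU gG Uu; apply: (partial_eq_on (U := U)) => // z Uz.
exact: riemannian_sym gG Uz.
Qed.

Lemma christoffel_sym U G k i j u : open U -> riemannian_on U G -> U u ->
  christoffel G u k i j = christoffel G u k j i.
Proof.
move=> oU gG Uu; rewrite /christoffel; congr (_ * _); apply: eq_bigr => l _.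
rewrite (partial_metric_sym i j l oU gG Uu).
by rewrite [partial i _ u + _]addrC.
Qed.

Lemma metric_compat U G k i j u : open U -> riemannian_on U G -> U u ->
  partial k (fun z => G z i j) u =
  christoffel1 G u k i j + christoffel1 G u k j i.
Proof.
move=> oU gG Uu; rewrite /christoffel1.
rewrite (partial_metric_sym j i k oU gG Uu).
by field.
Qed.

Lemma differentiable_christoffel U G k i j u : open U -> riemannian_on U G ->
  U u -> differentiable (fun z => christoffel G z k i j) u.
Proof.
move=> oU gG Uu.
have dG a b c : differentiable (partial a (fun z => G z b c)) u.
  exact: smooth_differentiable (smooth_partial a (metric_smooth b c oU gG)) Uu.
have dI a b := differentiable_inverse a b oU gG Uu.
rewrite /christoffel; apply: differentiableM; first exact: differentiable_cst.
rewrite (_ : (fun z => \sum_l _) = fun z =>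
  invmx (G z) k 0 * (partial i (fun z => G z j 0) z + partial j (fun z => G z i 0) z
     - partial 0 (fun z => G z i j) z) +
  invmx (G z) k 1 * (partial i (fun z => G z j 1) z + partial j (fun z => G z i 1) z
     - partial 1 (fun z => G z i j) z)); last by apply/funext => z; rewrite sum_ord2.
by apply: differentiableD; apply: differentiableM => //; apply: differentiableB => //;
  apply: differentiableD.
Qed.

Lemma differentiable_christoffel1 U G i j l u : open U -> riemannian_on U G ->
  U u -> differentiable (fun z => christoffel1 G z i j l) u.
Proof.
move=> oU gG Uu.
have dG a b c : differentiable (partial a (fun z => G z b c)) u.
  exact: smooth_differentiable (smooth_partial a (metric_smooth b c oU gG)) Uu.
apply: differentiableM; first exact: differentiable_cst.
by apply: differentiableB => //; apply: differentiableD.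
Qed.

Lemma metric_differentiable U G i j u : open U -> riemannian_on U G -> U u ->
  differentiable (fun z => G z i j) u.
Proof. by move=> oU gG; exact: smooth_differentiable (metric_smooth i j oU gG). Qed.

End Metric.

(** * The curvature tensor *)

Section Curvature.
Context {R : realType}.
#[local] Opaque partial christoffel christoffel1.
Implicit Types (U : set 'rV[R]_2) (G H : 'rV[R]_2 -> 'M[R]_2) (u v w : 'rV[R]_2).
Implicit Types (i j k l m : 'I_2).

(** The component along [d_l] of [R(d_0,d_1) d_k]. *)
Definition riemann G u k l : R :=
  (partial 0 (fun z => christoffel G z l 1 k) u
    + \sum_m christoffel G u m 1 k * christoffel G u l 0 m)
  - (partial 1 (fun z => christoffel G z l 0 k) u
    + \sum_m christoffel G u m 0 k * christoffel G u l 1 m).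

Lemma nabla_coord G i Y u k : differentiable Y u ->
  nabla G (coord_field i) Y u 0 k =
  partial i (fun z => Y z 0 k) u + \sum_j Y u 0 j * christoffel G u k i j.
Proof.
move=> dY; rewrite /nabla summxE (bigD1 i) //= [X in _ + X]big1 ?addr0 => [|j ji].
  rewrite !mxE !eqxx /= mul1r partial_entry // summxE; congr (_ + _).
  by apply: eq_bigr => j _; rewrite !mxE.
by rewrite !mxE (negPf ji) mul0r.
Qed.

Lemma nabla_coord_coord G i j u :
  nabla G (coord_field i) (coord_field j) u = \row_k christoffel G u k i j.
Proof.
apply/matrixP => a k; rewrite !ord1 nabla_coord; last exact: differentiable_cst.
rewrite partial_cst add0r (bigD1 j) //= [X in _ + X]big1 ?addr0 => [|m mj].
  by rewrite !mxE !eqxx /= mul1r.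
by rewrite !mxE (negPf mj) mul0r.
Qed.

Lemma nabla_nabla U G i j k l u : open U -> riemannian_on U G -> U u ->
  nabla G (coord_field i) (nabla G (coord_field j) (coord_field k)) u 0 l =
  partial i (fun z => christoffel G z l j k) u
    + \sum_m christoffel G u m j k * christoffel G u l i m.
Proof.
move=> oU gG Uu.
have -> : nabla G (coord_field j) (coord_field k) =
    fun z => \row_k0 christoffel G z k0 j k.
  by apply/funext => z; rewrite nabla_coord_coord.
rewrite nabla_coord; last first.
  apply: differentiable_row => m.
  rewrite (_ : (fun z => _) = fun z => christoffel G z m j k).
    exact: differentiable_christoffel Uu.
  by apply/funext => z; rewrite mxE.
have -> : (fun z => (\row_k0 christoffel G z k0 j k) 0 l) =
    fun z => christoffel G z l j k by apply/funext => z; rewrite mxE.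
by under eq_bigr do rewrite mxE.
Qed.

Lemma gauss_curvatureE U G u : open U -> riemannian_on U G -> U u ->
  gauss_curvature G u * \det (G u) = \sum_l riemann G u 1 l * G u l 0.
Proof.
move=> oU gG Uu; rewrite /gauss_curvature mulrVK; last first.
  by rewrite unitfE; apply/lt0r_neq0/(riemannian_det gG Uu).
rewrite /bilin mxE (bigD1 0) //= [X in _ + X]big1 ?addr0 => [|j j0].
  rewrite !mxE !eqxx /= mulr1; apply: eq_bigr => l _.
  by congr (_ * _); rewrite 2!mxE !(nabla_nabla _ _ _ _ oU gG Uu).
by rewrite !mxE (negPf j0) mulr0.
Qed.

(** With the index lowered, the derivatives of the inverse metric
    disappear: differentiating [Gamma^l_jk G_lm] absorbs them into Christoffel symbols of
    the first kind. *)
Lemma riemann_lower U G k m u : open U -> riemannian_on U G -> U u ->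
  \sum_l riemann G u k l * G u l m =
    partial 0 (fun z => christoffel1 G z 1 k m) u
    - partial 1 (fun z => christoffel1 G z 0 k m) u
    + \sum_l christoffel G u l 0 k * christoffel1 G u 1 m l
    - \sum_l christoffel G u l 1 k * christoffel1 G u 0 m l.
Proof.
move=> oU gG Uu.
have E i j : partial i (fun z => christoffel1 G z j k m) u =
  \sum_l (partial i (fun z => christoffel G z l j k) u * G u l m
   + christoffel G u l j k * (christoffel1 G u i l m + christoffel1 G u i m l)).
  have -> : partial i (fun z => christoffel1 G z j k m) u =
    partial i (fun z => christoffel G z 0 j k * G z 0 m
       + christoffel G z 1 j k * G z 1 m) u.
    apply: (partial_eq_on (U := U)) => // z Uz.
    by rewrite -(christoffel_lower j k m gG Uz) sum_ord2.
  have dC l := differentiable_christoffel l j k oU gG Uu.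
  have dG a b := metric_differentiable a b oU gG Uu.
  rewrite partialMDM // !sum_ord2.
  rewrite (metric_compat i 0 m oU gG Uu) (metric_compat i 1 m oU gG Uu).
  do ![move: (partial _ _ _) => ?].
  do ![move: (christoffel1 _ _ _ _ _) => ?].
  do ![move: (christoffel _ _ _ _ _) => ?].
  do ![move: (G u _ _) => ?].
  ring.
rewrite !E /riemann !sum_ord2 -!(christoffel_lower _ _ _ gG Uu) !sum_ord2.
do ![move: (partial _ _ _) => ?].
do ![move: (christoffel _ _ _ _ _) => ?].
do ![move: (G u _ _) => ?].
ring.
Qed.

(** In the lowered form the second derivatives of [G] enter only through
    the difference of its two mixed derivatives, and the quadratic terms cancel in pairs. *)
Lemma riemann_skew U G k m u : open U -> riemannian_on U G -> U u ->
  \sum_l riemann G u k l * G u l m + \sum_l riemann G u m l * G u l k = 0.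
Proof.
move=> oU gG Uu; rewrite !(riemann_lower _ _ oU gG Uu).
have E i j : partial i (fun z => christoffel1 G z j k m) u
    + partial i (fun z => christoffel1 G z j m k) u =
    partial i (partial j (fun z => G z k m)) u.
  rewrite -partialD; try exact: (differentiable_christoffel1 _ _ _ oU gG Uu).
  apply: (partial_eq_on (U := U)) => // z Uz.
  by rewrite (metric_compat _ _ _ oU gG Uz).
have := partialC 0 1 oU (metric_smooth k m oU gG) Uu; rewrite -!E.
set a := partial _ _ _; set b := partial _ _ _; set c := partial _ _ _.
set d := partial _ _ _ => abcd.
have S : \sum_l christoffel G u l 0 k * christoffel1 G u 1 m l =
   \sum_l christoffel G u l 1 m * christoffel1 G u 0 k l.
  rewrite !sum_ord2 -!(christoffel_lower _ _ _ gG Uu) !sum_ord2.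
  rewrite (riemannian_sym 1 0 gG Uu).
  do ![move: (christoffel _ _ _ _ _) => ?].
  do ![move: (G u _ _) => ?].
  ring.
have S' : \sum_l christoffel G u l 0 m * christoffel1 G u 1 k l =
   \sum_l christoffel G u l 1 k * christoffel1 G u 0 m l.
  rewrite !sum_ord2 -!(christoffel_lower _ _ _ gG Uu) !sum_ord2.
  rewrite (riemannian_sym 1 0 gG Uu).
  do ![move: (christoffel _ _ _ _ _) => ?].
  do ![move: (G u _ _) => ?].
  ring.
rewrite S S'; lra.
Qed.

End Curvature.

(** * Codazzi pairs of metrics *)

(** Certificates for equational reasoning modulo hypotheses: the cofactor is
    supplied by hand, and the remaining identity is one of commutative rings. *)
Lemma eq_of_multiple (F : pzRingType) (c a b l r : F) :
  l = r -> a - b = c * (l - r) -> a = b.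
Proof. by move=> -> /eqP; rewrite subrr mulr0 subr_eq0 => /eqP. Qed.

Lemma eq_of_multiple2 (F : pzRingType) (c d a b l r l' r' : F) :
  l = r -> l' = r' -> a - b = c * (l - r) + d * (l' - r') -> a = b.
Proof. by move=> -> -> /eqP; rewrite !subrr !mulr0 addr0 subr_eq0 => /eqP. Qed.

Section CodazziPair.
Context {R : realType}.
#[local] Opaque partial christoffel christoffel1.
Implicit Types (U : set 'rV[R]_2) (G H : 'rV[R]_2 -> 'M[R]_2) (u v w : 'rV[R]_2).
Implicit Types (i j k l m : 'I_2).

Definition covariant_derivative G H u k i j : R :=
  partial k (fun z => H z i j) u
  - \sum_l christoffel G u l k i * H u l j
  - \sum_l christoffel G u l k j * H u i l.

(** Symmetry in the first two of the three indices makes the covariant derivative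
    totally symmetric, since [H] itself is symmetric. *)
Definition codazzi_on U G H : Prop :=
  forall u i j k, U u ->
    covariant_derivative G H u k i j = covariant_derivative G H u i k j.

(** The components of [difference_tensor] in the coordinate frame. *)
Definition difference_coef H G u l i j : R :=
  christoffel H u l i j - christoffel G u l i j.

(** For a Codazzi pair this is half the covariant derivative of [H]. *)
Definition cubic_form H G u i j k : R :=
  \sum_l difference_coef H G u l i j * H u l k.

Lemma cubic_form_sym12 U G H u i j k : open U -> riemannian_on U G ->
  riemannian_on U H -> U u -> cubic_form H G u i j k = cubic_form H G u j i k.
Proof.
move=> oU gG gH Uu; apply: eq_bigr => l _; rewrite /difference_coef.
by rewrite (christoffel_sym l i j oU gG Uu) (christoffel_sym l i j oU gH Uu).
Qed.

(** [H] is parallel for its own connection, so only the difference of the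
    two connections contributes. *)
Lemma covariant_derivativeE U G H u k i j : open U -> riemannian_on U G ->
  riemannian_on U H -> U u -> covariant_derivative G H u k i j =
  cubic_form H G u k i j + cubic_form H G u k j i.
Proof.
move=> oU gG gH Uu; rewrite /covariant_derivative (metric_compat k i j oU gH Uu).
rewrite -!(christoffel_lower _ _ _ gH Uu) /cubic_form /difference_coef !sum_ord2.
rewrite !(riemannian_sym i _ gH Uu).
do ![move: (christoffel _ _ _ _ _) => ?].
do ![move: (H u _ _) => ?].
ring.
Qed.

(** In the Codazzi equation the terms that [covariant_derivativeE] shares
    between both sides cancel, by the symmetry in the first two indices. *)
Lemma cubic_form_sym13 U G H u i j k : open U -> riemannian_on U G ->
  riemannian_on U H -> codazzi_on U G H -> U u ->
  cubic_form H G u i j k = cubic_form H G u k j i.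
Proof.
move=> oU gG gH cod Uu; have := cod u i j k Uu.
rewrite !(covariant_derivativeE _ _ _ oU gG gH Uu).
rewrite (cubic_form_sym12 i k j oU gG gH Uu).
by move/addrI => <-.
Qed.

(** The Codazzi equation trades half of the first derivatives of [H] for
    terms of order zero. In this form and in [codazzi_christoffel1_01] the remaining
    derivative is that of the single function [H_01], so that the second derivatives in the
    curvature of [H] become its two mixed derivatives and cancel. *)
Lemma codazzi_christoffel1_11 U G H u : open U -> riemannian_on U G ->
  riemannian_on U H -> codazzi_on U G H -> U u ->
  christoffel1 H u 1 1 0 = 2^-1 * (partial 1 (fun z => H z 0 1) u
    + ((christoffel G u 0 1 1 * H u 0 0 + christoffel G u 1 1 1 * H u 0 1)
       - (christoffel G u 0 1 0 * H u 0 1 + christoffel G u 1 1 0 * H u 1 1))).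
Proof.
move=> oU gG gH cod Uu; have := cubic_form_sym13 0 1 1 oU gG gH cod Uu.
rewrite (metric_compat 1 0 1 oU gH Uu) -!(christoffel_lower _ _ _ gH Uu).
rewrite /cubic_form /difference_coef !sum_ord2 (riemannian_sym 1 0 gH Uu).
rewrite !(christoffel_sym _ 1 0 oU gH Uu) !(christoffel_sym _ 1 0 oU gG Uu).
do ![move: (christoffel _ _ _ _ _) => ?].
do ![move: (H u _ _) => ?].
by move=> E; apply: (eq_of_multiple (c := - 2^-1) E); field.
Qed.

Lemma codazzi_christoffel1_01 U G H u : open U -> riemannian_on U G ->
  riemannian_on U H -> codazzi_on U G H -> U u ->
  christoffel1 H u 0 1 0 = 2^-1 * (partial 0 (fun z => H z 0 1) u
    + ((christoffel G u 0 0 1 * H u 0 0 + christoffel G u 1 0 1 * H u 0 1)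
       - (christoffel G u 0 0 0 * H u 0 1 + christoffel G u 1 0 0 * H u 1 1))).
Proof.
move=> oU gG gH cod Uu; have := cubic_form_sym13 0 0 1 oU gG gH cod Uu.
rewrite (metric_compat 0 0 1 oU gH Uu) -!(christoffel_lower _ _ _ gH Uu).
rewrite /cubic_form /difference_coef !sum_ord2 (riemannian_sym 1 0 gH Uu).
rewrite !(christoffel_sym _ 1 0 oU gH Uu) !(christoffel_sym _ 1 0 oU gG Uu).
do ![move: (christoffel _ _ _ _ _) => ?].
do ![move: (H u _ _) => ?].
by move=> E; apply: (eq_of_multiple (c := - 2^-1) E); field.
Qed.

Lemma partial_codazzi H U i (a b c d : 'rV[R]_2 -> R) (f : 'rV[R]_2 -> R) u :
  open U -> riemannian_on U H -> U u ->
  differentiable a u -> differentiable b u -> differentiable c u -> differentiable d u ->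
  differentiable f u ->
  partial i (fun z => 2^-1 * (f z + ((a z * H z 0 0 + b z * H z 0 1)
     - (c z * H z 0 1 + d z * H z 1 1)))) u =
  2^-1 * (partial i f u + (((partial i a u * H u 0 0 + a u * partial i (fun z => H z 0 0) u)
       + (partial i b u * H u 0 1 + b u * partial i (fun z => H z 0 1) u))
     - ((partial i c u * H u 0 1 + c u * partial i (fun z => H z 0 1) u)
       + (partial i d u * H u 1 1 + d u * partial i (fun z => H z 1 1) u)))).
Proof.
move=> oU gH Uu da db dc dd df.
have dH j k := metric_differentiable j k oU gH Uu.
have dab : differentiable (fun z => a z * H z 0 0 + b z * H z 0 1) u.
  by apply: differentiableD; apply: differentiableM.
have dcd : differentiable (fun z => c z * H z 0 1 + d z * H z 1 1) u.
  by apply: differentiableD; apply: differentiableM.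
rewrite partialM; [|exact: differentiable_cst|].
  rewrite partial_cst mul0r add0r partialD //; last exact: differentiableB.
  rewrite partialD //; last exact: differentiableN.
  by rewrite partialN // !partialMDM.
by apply: differentiableD => //; apply: differentiableB.
Qed.

(** What survives of the second derivatives of [H] is the derivative of the
    Christoffel symbols of [G], that is, the curvature of [G] acting on [H]; the quadratic
    terms assemble into [|L_01|^2 - <L_00,L_11>]. *)
Lemma codazzi_gauss_curvature U G H u : open U -> riemannian_on U G ->
  riemannian_on U H -> codazzi_on U G H -> U u ->
  gauss_curvature H u * \det (H u) =
  2^-1 * (\sum_l riemann G u 1 l * H u l 0 - \sum_l riemann G u 0 l * H u l 1)
  + \sum_l \sum_m (difference_coef H G u l 0 1 * difference_coef H G u m 0 1
       - difference_coef H G u l 0 0 * difference_coef H G u m 1 1) * H u l m.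
Proof.
move=> oU gG gH cod Uu.
have dG l i j := differentiable_christoffel l i j oU gG Uu.
have dH i j k : differentiable (partial k (fun z => H z i j)) u.
  exact: smooth_differentiable (smooth_partial k (metric_smooth i j oU gH)) Uu.
rewrite (gauss_curvatureE oU gH Uu) (riemann_lower 1 0 oU gH Uu).
rewrite (partial_eq_on (U := U) (f := fun z => christoffel1 H z 1 1 0)
  0 oU (fun z Uz => codazzi_christoffel1_11 oU gG gH cod Uz) Uu).
rewrite (partial_eq_on (U := U) (f := fun z => christoffel1 H z 0 1 0)
  1 oU (fun z Uz => codazzi_christoffel1_01 oU gG gH cod Uz) Uu).
rewrite !(partial_codazzi _ oU gH Uu) //.
rewrite (partialC 0 1 oU (metric_smooth 0 1 oU gH) Uu).
rewrite !(metric_compat _ _ _ oU gH Uu) /riemann !sum_ord2.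
rewrite -!(christoffel_lower _ _ _ gH Uu) !sum_ord2.
have E1 := cubic_form_sym13 0 0 1 oU gG gH cod Uu.
have E2 := cubic_form_sym13 0 1 1 oU gG gH cod Uu.
(* The cofactors collect the terms linear in L, where the cubic form is met with its
   indices in two different orders. *)
apply: (eq_of_multiple2 (c := - 2^-1 * (christoffel G u 1 1 1 + christoffel G u 0 0 1))
  (d := 2^-1 * (christoffel G u 1 0 1 + christoffel G u 0 0 0)) E1 E2).
rewrite /cubic_form /difference_coef !sum_ord2.
rewrite (riemannian_sym 1 0 gH Uu).
rewrite !(christoffel_sym _ 1 0 oU gH Uu) !(christoffel_sym _ 1 0 oU gG Uu).
do ![move: (partial _ _ _) => ?].
do ![move: (christoffel _ _ _ _ _) => ?].
do ![move: (H u _ _) => ?].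
by field.
Qed.

Lemma difference_tensorE G H u v w k :
  difference_tensor H G u v w 0 k =
  \sum_i \sum_j v 0 i * w 0 j * difference_coef H G u k i j.
Proof.
have E F : nabla F (fun=> v) (fun=> w) u 0 k =
    \sum_i \sum_j v 0 i * w 0 j * christoffel F u k i j.
  rewrite /nabla summxE; apply: eq_bigr => i _.
  rewrite mxE partial_cst add0r summxE mulr_sumr; apply: eq_bigr => j _.
  by rewrite !mxE mulrA.
have -> : \sum_i \sum_j v 0 i * w 0 j * difference_coef H G u k i j =
    \sum_i \sum_j v 0 i * w 0 j * christoffel H u k i j
    - \sum_i \sum_j v 0 i * w 0 j * christoffel G u k i j.
  rewrite !sum_ord2 /difference_coef.
  do ![move: (christoffel _ _ _ _ _) => ?].
  by ring.
rewrite -(E H) -(E G) /difference_tensor.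
by move: (nabla H _ _ u) (nabla G _ _ u) => A B; rewrite !mxE.
Qed.

Lemma bilin_deltar (B : 'M[R]_2) v k :
  bilin B v (delta_mx 0 k) = \sum_l v 0 l * B l k.
Proof. by rewrite /bilin trmx_delta -colE !mxE. Qed.

(** Jacobi's formula; the trace of [G^-1] against the derivative of [G] is twice
    the trace of the Christoffel symbols. *)
Lemma partial_det U G k u : open U -> riemannian_on U G -> U u ->
  partial k (fun z => \det (G z)) u =
  2 * \det (G u) * \sum_l christoffel G u l k l.
Proof.
move=> oU gG Uu; have dG a b := metric_differentiable a b oU gG Uu.
have -> : (fun z => \det (G z)) = fun z => G z 0 0 * G z 1 1 + G z 0 1 * - G z 1 0.
  by apply/funext => z; rewrite det2 mulrN.
rewrite partialMDM //; last exact: differentiableN.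
rewrite partialN // (metric_compat k 0 0 oU gG Uu) (metric_compat k 0 1 oU gG Uu).
rewrite (metric_compat k 1 0 oU gG Uu) (metric_compat k 1 1 oU gG Uu).
rewrite det2 -!(christoffel_lower _ _ _ gG Uu) !sum_ord2 (riemannian_sym 1 0 gG Uu).
do ![move: (christoffel _ _ _ _ _) => ?].
do ![move: (G u _ _) => ?].
ring.
Qed.

Lemma differentiable_det U G u : open U -> riemannian_on U G -> U u ->
  differentiable (fun z => \det (G z)) u.
Proof.
move=> oU gG Uu; have dG a b := metric_differentiable a b oU gG Uu.
rewrite (_ : (fun z => _) = fun z => G z 0 0 * G z 1 1 - G z 0 1 * G z 1 0).
  by apply: differentiableB; apply: differentiableM.
by apply/funext => z; rewrite det2.
Qed.

Lemma partial_det_ratio U G H k u : open U -> riemannian_on U G ->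
  riemannian_on U H -> U u ->
  partial k (fun z => \det (H z) / \det (G z)) u =
  2 * (\det (H u) / \det (G u)) * \sum_l difference_coef H G u l k l.
Proof.
move=> oU gG gH Uu.
have G0 := lt0r_neq0 (riemannian_det gG Uu).
have dG := differentiable_det oU gG Uu.
rewrite partialM; [|exact: differentiable_det gH Uu|exact: differentiableV].
rewrite partialV // (partial_det k oU gG Uu) (partial_det k oU gH Uu).
rewrite /difference_coef !sum_ord2.
do ![move: (christoffel _ _ _ _ _) => ?].
by move: (\det (H u)) (\det (G u)) G0 => ? ? ?; field.
Qed.

(** The rows of an orthonormal frame form a matrix [W] with [W B W^T = 1], hence
    [W^T W] is the inverse of the Gram matrix [B]. *)
Lemma orthonormal_frame_dual (B : 'M[R]_2) (w : 'I_2 -> 'rV[R]_2) i k :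
  orthonormal_frame B w ->
  \sum_j \sum_l w j 0 i * w j 0 l * B l k = (i == k)%:R.
Proof.
move=> ow; pose W : 'M[R]_2 := \matrix_(a, b) w a 0 b.
have WBW : W *m (B *m W^T) = 1%:M.
  apply/matrixP => a b; rewrite mulmxA !mxE -[RHS]ow /bilin !mxE.
  apply: eq_bigr => c _; rewrite !mxE; congr (_ * _).
  by apply: eq_bigr => d _; rewrite !mxE.
have {}WBW : W^T *m W *m B = 1%:M.
  by apply: mulmx1C; rewrite mulmxA; apply: mulmx1C.
have := congr1 (fun A : 'M[R]_2 => A i k) WBW; rewrite !mxE => <-.
rewrite exchange_big /=; apply: eq_bigr => l _; rewrite !mxE mulr_suml.
by apply: eq_bigr => j _; rewrite !mxE.
Qed.

Lemma orthonormal_frame_det (B : 'M[R]_2) (w : 'I_2 -> 'rV[R]_2) :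
  orthonormal_frame B w ->
  (w 0 0 0 * w 1 0 1 - w 0 0 1 * w 1 0 0) ^+ 2 * \det B = 1.
Proof.
move=> ow; have := ow 0 0; have := ow 0 1; have := ow 1 0; have := ow 1 1.
rewrite !bilinE /= ?mulr1n ?mulr0n det2 => E11 E10 E01 E00.
transitivity ((1 : R) * 1 - 0 * 0); last by ring.
rewrite -[X in _ = X * _ - _]E00 -[X in _ = _ * X - _]E11 -[X in _ = _ - X * _]E01.
rewrite -[X in _ = _ - _ * X]E10.
do ![move: (B _ _) => ?].
do ![move: (w _ _ _) => ?].
ring.
Qed.

(** Both sides are the trace of [A] with respect to [B], times [det B]: the right
    one evaluates the inverse of [B] by its adjugate. *)
Lemma trace_frame (A B : 'M[R]_2) (w : 'I_2 -> 'rV[R]_2) :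
  A 1 0 = A 0 1 -> B 1 0 = B 0 1 ->
  orthonormal_frame B w -> (\sum_i bilin A (w i) (w i)) * \det B =
  A 1 1 * B 0 0 - 2 * A 0 1 * B 0 1 + A 0 0 * B 1 1.
Proof.
move=> sA sB ow.
have := orthonormal_frame_dual 0 0 ow; have := orthonormal_frame_dual 0 1 ow.
have := orthonormal_frame_dual 1 0 ow; have := orthonormal_frame_dual 1 1 ow.
rewrite !sum_ord2 !bilinE det2 sA sB /= ?mulr1n ?mulr0n.
move: (A 0 0) (A 0 1) (A 1 1) (B 0 0) (B 0 1) (B 1 1) => s t v p q r.
move: (w 0 0 0) (w 0 0 1) (w 1 0 0) (w 1 0 1) => a b c d E11 E10 E01 E00.
have M00 : (a * a + c * c) * (p * r - q * q) = r.
  by apply: (eq_of_multiple2 (c := r) (d := - q) E00 E01); ring.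
have M01 : (a * b + c * d) * (p * r - q * q) = - q.
  by apply: (eq_of_multiple2 (c := p) (d := - q) E01 E00); ring.
have M11 : (b * b + d * d) * (p * r - q * q) = p.
  by apply: (eq_of_multiple2 (c := p) (d := - q) E11 E10); ring.
transitivity (v * ((b * b + d * d) * (p * r - q * q))
  + 2 * t * ((a * b + c * d) * (p * r - q * q))
  + s * ((a * a + c * c) * (p * r - q * q))); first by ring.
by rewrite M00 M01 M11; ring.
Qed.

Section TensorInFrame.
Variables (B : 'M[R]_2) (w : 'I_2 -> 'rV[R]_2) (T : 'rV[R]_2 -> 'rV[R]_2 -> 'rV[R]_2).
Variable L : 'I_2 -> 'I_2 -> 'I_2 -> R.
Hypothesis TE : forall v v' k, T v v' 0 k = \sum_i \sum_j v 0 i * v' 0 j * L k i j.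
Hypothesis Bsym : B 1 0 = B 0 1.
Hypothesis wB : orthonormal_frame B w.

(** Total symmetry exchanges the trace over the two arguments of [T] with the
    trace of the endomorphism [T (d_k, .)], which is frame independent. *)
Lemma trace_in_frame k :
  (forall i j m, \sum_l L l i j * B l m = \sum_l L l m j * B l i) ->
  bilin B (\sum_i T (w i) (w i)) (delta_mx 0 k) = \sum_l L l k l.
Proof.
move=> sym13.
transitivity (\sum_i \sum_a \sum_b w i 0 a * w i 0 b * \sum_l L l a b * B l k).
  rewrite bilin_deltar !sum_ord2 !mxE !TE !sum_ord2.
  do ![move: (L _ _ _) => ?].
  do ![move: (B _ _) => ?].
  do ![move: (w _ _ _) => ?].
  ring.
transitivity (\sum_b \sum_m L m k b * \sum_j \sum_l w j 0 b * w j 0 l * B l m).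
  rewrite !sum_ord2; have := sym13 0 0 k; have := sym13 0 1 k.
  have := sym13 1 0 k; have := sym13 1 1 k; rewrite !sum_ord2 => -> -> -> ->.
  rewrite Bsym.
  do ![move: (L _ _ _) => ?].
  do ![move: (B _ _) => ?].
  do ![move: (w _ _ _) => ?].
  ring.
apply: eq_bigr => b _; rewrite (bigD1 b) //= [X in _ + X]big1 ?addr0 => [|m mb].
  by rewrite (orthonormal_frame_dual _ _ wB) eqxx mulr1.
by rewrite (orthonormal_frame_dual _ _ wB) eq_sym (negPf mb) mulr0.
Qed.

(** In the frame the difference on the left is
    [2 (|T_01|^2 - <T_00,T_11>)], a quantity that a change of frame multiplies by the square
    of its determinant. *)
Lemma norm_minus_trace_in_frame : (forall l, L l 1 0 = L l 0 1) ->
  (\sum_i \sum_j bilin B (T (w i) (w j)) (T (w i) (w j))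
   - bilin B (\sum_i T (w i) (w i)) (\sum_i T (w i) (w i))) * \det B =
  2 * \sum_l \sum_m (L l 0 1 * L m 0 1 - L l 0 0 * L m 1 1) * B l m.
Proof.
move=> sL; rewrite -[RHS]mulr1 -[X in _ = _ * X](orthonormal_frame_det wB) mulrA.
congr (_ * _).
rewrite !sum_ord2 !bilinE !mxE !TE !sum_ord2 !sL Bsym.
move: (L 0 0 0) (L 0 0 1) (L 0 1 1) (L 1 0 0) (L 1 0 1) (L 1 1 1).
move: (B 0 0) (B 0 1) (B 1 1).
move: (w 0 0 0) (w 0 0 1) (w 1 0 0) (w 1 0 1) => a b c d p q r x0 x1 x2 y0 y1 y2.
ring.
Qed.
End TensorInFrame.

#[local] Opaque gauss_curvature riemann difference_tensor.

(** On a surface skew-symmetry leaves one curvature component, so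
    [R(d_0,d_1) d_1 = K (G_11 d_0 - G_01 d_1)] and
    [R(d_0,d_1) d_0 = K (G_01 d_0 - G_00 d_1)]. *)
Lemma riemann_contract U G (B : 'M[R]_2) u : open U -> riemannian_on U G -> U u ->
  B 1 0 = B 0 1 ->
  \sum_l riemann G u 1 l * B l 0 - \sum_l riemann G u 0 l * B l 1 =
  gauss_curvature G u * (G u 1 1 * B 0 0 - 2 * G u 0 1 * B 0 1 + G u 0 0 * B 1 1).
Proof.
move=> oU gG Uu sB; have D0 := lt0r_neq0 (riemannian_det gG Uu).
have := gauss_curvatureE oU gG Uu; have := riemann_skew 1 0 oU gG Uu.
have := riemann_skew 1 1 oU gG Uu; have := riemann_skew 0 0 oU gG Uu.
move: (gauss_curvature G u) (riemann G u) D0 => K r.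
rewrite det2 !sum_ord2 sB (riemannian_sym 1 0 gG Uu).
move: (r 0 0) (r 0 1) (r 1 0) (r 1 1) (G u 0 0) (G u 0 1) (G u 1 1) => a b c d p q s.
move: (B 0 0) (B 0 1) (B 1 1) => x y z D0 E00 E11 E10 EK.
have {}E00 : a * p + b * q = 0.
  by apply: (eq_of_multiple (c := 2^-1) E00); field.
have {}E11 : c * q + d * s = 0.
  by apply: (eq_of_multiple (c := 2^-1) E11); field.
have E01 : a * q + b * s = - (K * (p * s - q * q)).
  by rewrite EK; apply/eqP; rewrite -addr_eq0 [X in X == 0]addrC; apply/eqP.
have -> : a = K * q.
  apply: (mulIf D0); apply: (eq_of_multiple2 (c := s) (d := - q) E00 E01); ring.
have -> : b = - (K * p).
  apply: (mulIf D0); apply: (eq_of_multiple2 (c := - q) (d := p) E00 E01); ring.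
have -> : c = K * s.
  apply: (mulIf D0); apply: (eq_of_multiple2 (c := - q) (d := - s) E11 EK); ring.
have -> : d = - (K * q).
  apply: (mulIf D0); apply: (eq_of_multiple2 (c := p) (d := q) E11 EK); ring.
ring.
Qed.

(** The gradient of [d] is [2 d] times the trace [S] of the difference
    tensor, so the last term is [<S,S>] and [norm_minus_trace_in_frame] turns
    [codazzi_gauss_curvature] into the claim. *)
Theorem codazzi_pair_curvature U G H u (w : 'I_2 -> 'rV[R]_2) :
  open U -> riemannian_on U G -> riemannian_on U H -> codazzi_on U G H -> U u ->
  orthonormal_frame (H u) w ->
  let d := fun z => \det (H z) / \det (G z) in
  2 * gauss_curvature H u =
  gauss_curvature G u * (\sum_i bilin (G u) (w i) (w i))
  + \sum_i \sum_j bilin (H u) (difference_tensor H G u (w i) (w j))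
                              (difference_tensor H G u (w i) (w j))
  - (4 * d u ^+ 2)^-1 * bilin (H u) (gradient H d u) (gradient H d u).
Proof.
move=> oU gG gH cod Uu ow d.
have DG := lt0r_neq0 (riemannian_det gG Uu).
have DH := lt0r_neq0 (riemannian_det gH Uu).
have d0 : d u != 0 by rewrite mulf_neq0 ?invr_neq0.
pose S := \sum_i difference_tensor H G u (w i) (w i).
have gradE : gradient H d u = (2 * d u) *: S.
  rewrite /gradient -[RHS](mulmxK (riemannian_unit gH Uu)); congr (_ *m _).
  apply/matrixP => a k; rewrite !ord1 mxE -scalemxAl.
  rewrite (partial_det_ratio k oU gG gH Uu) [RHS]mxE; congr (_ * _).
  rewrite -(trace_in_frame (difference_tensorE G H u) (riemannian_sym 1 0 gH Uu) ow).
    by rewrite bilin_deltar mxE.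
  by move=> i j m; apply: (cubic_form_sym13 i j m oU gG gH cod Uu).
have bilinZ c s : bilin (H u) (c *: s) (c *: s) = c ^+ 2 * bilin (H u) s s.
  by rewrite !bilinE !mxE; ring.
rewrite gradE bilinZ.
have -> : (4 * d u ^+ 2)^-1 * ((2 * d u) ^+ 2 * bilin (H u) S S) = bilin (H u) S S.
  by move: (d u) (bilin _ _ _) d0 => ? ? ?; field.
have KH := codazzi_gauss_curvature oU gG gH cod Uu.
rewrite (riemann_contract oU gG Uu (riemannian_sym 1 0 gH Uu)) in KH.
rewrite -(trace_frame (riemannian_sym 1 0 gG Uu) (riemannian_sym 1 0 gH Uu) ow) in KH.
have sL l : difference_coef H G u l 1 0 = difference_coef H G u l 0 1.
  rewrite /difference_coef.
  by rewrite (christoffel_sym l 1 0 oU gG Uu) (christoffel_sym l 1 0 oU gH Uu).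
have := norm_minus_trace_in_frame (difference_tensorE G H u) (riemannian_sym 1 0 gH Uu) ow sL.
rewrite -/S; move: KH.
move: (\sum_i bilin (G u) _ _) (\sum_i \sum_j bilin _ _ _) => t N.
move: (\sum_l _) (bilin (H u) S S) (gauss_curvature G u) (gauss_curvature H u).
move=> Q n K K' KH NQ.
apply: (mulIf DH); move: (\det (H u)) KH NQ => D KH NQ.
by apply: (eq_of_multiple2 (c := 2) (d := - 1) KH NQ); field.
Qed.

End CodazziPair.

(** * The Lorentz product *)

Section LorentzProduct.
Context {R : realType}.
#[local] Opaque partial.
Implicit Types (a b c : 'rV[R]_4) (A B : 'rV[R]_2 -> 'rV[R]_4) (u : 'rV[R]_2).

Lemma lorentzE a b : lorentz a b =
  (a 0 0 * - b 0 0 + a 0 (lift 0 0) * b 0 (lift 0 0))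
  + (a 0 (lift 0 1) * b 0 (lift 0 1) + a 0 (lift 0 2) * b 0 (lift 0 2)).
Proof.
rewrite /lorentz !big_ord_recl big_ord0 addr0 mulrN !addrA.
by do ![congr (_ + _)]; congr (a _ _ * b _ _); do ?[congr (lift _ _)]; apply: val_inj.
Qed.

Lemma lorentzC a b : lorentz a b = lorentz b a.
Proof. by rewrite !lorentzE; ring. Qed.

Lemma lorentzDl a b c : lorentz (a + b) c = lorentz a c + lorentz b c.
Proof. by rewrite !lorentzE !mxE; ring. Qed.

Lemma lorentzZl (r : R) a b : lorentz (r *: a) b = r * lorentz a b.
Proof. by rewrite !lorentzE !mxE; ring. Qed.

Lemma lorentzNl a b : lorentz (- a) b = - lorentz a b.
Proof. by rewrite !lorentzE !mxE; ring. Qed.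

Lemma lorentz0l a : lorentz 0 a = 0.
Proof. by rewrite !lorentzE !mxE; ring. Qed.

Lemma lorentz_suml (I : Type) (r : seq I) (P : pred I) (F : I -> 'rV[R]_4) a :
  lorentz (\sum_(i <- r | P i) F i) a = \sum_(i <- r | P i) lorentz (F i) a.
Proof.
by apply: (big_morph (lorentz^~ a)) => [b c|]; [exact: lorentzDl | exact: lorentz0l].
Qed.

Lemma lorentz_combination (p q r s : R) (a b c d v : 'rV[R]_4) :
  lorentz (p *: a + q *: b - r *: c - s *: d) v =
  p * lorentz a v + q * lorentz b v - r * lorentz c v - s * lorentz d v.
Proof. by rewrite !(lorentzDl, lorentzNl, lorentzZl). Qed.

Lemma lorentz_differentiable A B u : differentiable A u -> differentiable B u ->
  differentiable (fun z => lorentz (A z) (B z)) u.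
Proof.
move=> dA dB.
have dAk k : differentiable (fun z => A z 0 k) u by exact: differentiable_entry.
have dBk k : differentiable (fun z => B z 0 k) u by exact: differentiable_entry.
have -> : (fun z => lorentz (A z) (B z)) = (fun z =>
  (A z 0 0 * - B z 0 0 + A z 0 (lift 0 0) * B z 0 (lift 0 0))
  + (A z 0 (lift 0 1) * B z 0 (lift 0 1) + A z 0 (lift 0 2) * B z 0 (lift 0 2))).
  by apply/funext => z; rewrite lorentzE.
have dN : differentiable (fun z => - B z 0 0) u by exact: differentiableN.
by apply: differentiableD; apply: differentiableD; apply: differentiableM.
Qed.

Lemma lorentz_partial i A B u : differentiable A u -> differentiable B u ->
  partial i (fun z => lorentz (A z) (B z)) u =
  lorentz (partial i A u) (B u) + lorentz (A u) (partial i B u).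
Proof.
move=> dA dB.
have dAk k : differentiable (fun z => A z 0 k) u by exact: differentiable_entry.
have dBk k : differentiable (fun z => B z 0 k) u by exact: differentiable_entry.
have -> : (fun z => lorentz (A z) (B z)) = (fun z =>
  (A z 0 0 * - B z 0 0 + A z 0 (lift 0 0) * B z 0 (lift 0 0))
  + (A z 0 (lift 0 1) * B z 0 (lift 0 1) + A z 0 (lift 0 2) * B z 0 (lift 0 2))).
  by apply/funext => z; rewrite lorentzE.
have dN : differentiable (fun z => - B z 0 0) u by exact: differentiableN.
rewrite partialD; [|by apply: differentiableD; apply: differentiableM..].
rewrite !partialMDM // partialN // !partial_entry // !lorentzE.
move: (partial i A u) (partial i B u) => a b.
ring.
Qed.

Lemma lorentz_nondegenerate (f : 'I_4 -> 'rV[R]_4) v :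
  (forall c : 'I_4 -> R, \sum_i c i *: f i = 0 -> forall i, c i = 0) ->
  (forall i, lorentz (f i) v = 0) -> v = 0.
Proof.
move=> free orth; pose M : 'M[R]_4 := \matrix_i f i.
have uM : M \in unitmx.
  rewrite -row_free_unit; apply: inj_row_free => c cM.
  apply/matrixP => a i; rewrite ord1 mxE; apply: (free (fun i => c 0 i)).
  by rewrite -[RHS]cM mulmx_sum_row; apply: eq_bigr => k _; rewrite rowK.
(* Lowering the index of v reduces the Lorentz product to the standard pairing. *)
pose jv : 'rV[R]_4 := \row_k (if k == 0 then - v 0 0 else v 0 k).
have jE a : lorentz a v = (a *m jv^T) 0 0.
  rewrite /lorentz [RHS]mxE [in RHS]big_ord_recl !mxE /= mulrN; congr (_ + _).
  by apply: eq_bigr => k _; rewrite !mxE.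
have Mj : M *m jv^T = 0.
  apply/row_matrixP => i; rewrite row_mul rowK row0.
  by apply/matrixP => a b; rewrite !ord1 [RHS]mxE -jE.
have j0 : jv^T = 0 by rewrite -(mulKmx uM jv^T) Mj mulmx0.
apply/matrixP => a k; rewrite ord1 [RHS]mxE.
have := congr1 (fun N : 'cV[R]_4 => N k 0) j0; rewrite !mxE.
by case: eqP => [->|//] /eqP; rewrite oppr_eq0 => /eqP.
Qed.

(** The Gram matrix of [e 0, e 1, x, n] is a block sum of an invertible matrix
    and a hyperbolic plane, hence the four vectors form a basis. *)
Lemma lorentz_null_frame (e : 'I_2 -> 'rV[R]_4) x n v :
  (\matrix_(i, j) lorentz (e i) (e j)) \in unitmx ->
  (forall i, lorentz (e i) x = 0) -> (forall i, lorentz (e i) n = 0) ->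
  lorentz x x = 0 -> lorentz n n = 0 -> lorentz x n = 1 ->
  (forall i, lorentz (e i) v = 0) -> lorentz x v = 0 -> lorentz n v = 0 -> v = 0.
Proof.
move=> uG ex en xx nn xn ev xv nv.
pose f (i : 'I_(2 + 2)) := match fintype.split i with
  inl j => e j | inr j => if j == 0 then x else n end.
have fl j : f (lshift 2 j) = e j by rewrite /f (unsplitK (inl j)).
have fr j : f (rshift 2 j) = if j == 0 then x else n by rewrite /f (unsplitK (inr j)).
have splitI (P : 'I_(2 + 2) -> Prop) : (forall j, P (lshift 2 j)) ->
    (forall j, P (rshift 2 j)) -> forall i, P i.
  by move=> Pl Pr i; case: (split_ordP i) => j ->.
apply: (@lorentz_nondegenerate f); last first.
  by apply: splitI; [move=> j; rewrite fl | apply: forall_ord2; rewrite fr].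
move=> c; rewrite (@big_split_ord _ _ _ 2 2) /= !sum_ord2 !fl !fr /= => sum0.
have pair a : c (lshift 2 (0 : 'I_2)) * lorentz (e 0) a
    + c (lshift 2 (1 : 'I_2)) * lorentz (e 1) a
    + (c (rshift 2 (0 : 'I_2)) * lorentz x a + c (rshift 2 (1 : 'I_2)) * lorentz n a) = 0.
  by have := congr1 (lorentz^~ a) sum0; rewrite lorentz0l !lorentzDl !lorentzZl.
have := pair n; rewrite !en xn nn !mulr0 !addr0 add0r mulr1 => cx.
have := pair x; rewrite !ex xx (lorentzC n) xn !mulr0 !add0r mulr1 => cn.
apply: splitI; last by apply: forall_ord2; rewrite ?cx ?cn.
have : (\row_(j < 2) c (lshift 2 (j : 'I_2))) *m (\matrix_(i, j) lorentz (e i) (e j)) = 0.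
  apply/matrixP => a k; rewrite !mxE sum_ord2 !mxE.
  by have := pair (e k); rewrite cx cn !mul0r !addr0.
move/(congr1 (mulmx^~ (invmx (\matrix_(i, j) lorentz (e i) (e j))))).
rewrite mulmxK // mul0mx => /matrixP c0 j.
by have := c0 0 j; rewrite !mxE.
Qed.

Lemma null_frame_decomposition (e : 'I_2 -> 'rV[R]_4) x n v (c : 'I_2 -> R) p q :
  (\matrix_(i, j) lorentz (e i) (e j)) \in unitmx ->
  (forall i, lorentz (e i) x = 0) -> (forall i, lorentz (e i) n = 0) ->
  lorentz x x = 0 -> lorentz n n = 0 -> lorentz x n = 1 ->
  (forall k, lorentz v (e k) = \sum_l c l * lorentz (e l) (e k)) ->
  lorentz v x = - q -> lorentz v n = - p ->
  v = \sum_l c l *: e l - p *: x - q *: n.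
Proof.
move=> uG ex en xx nn xn ve vx vn; apply/eqP; rewrite -subr_eq0; apply/eqP.
apply: (lorentz_null_frame uG ex en xx nn xn) => [k||];
  rewrite lorentzC lorentzDl lorentzNl sum_ord2 lorentz_combination.
- by rewrite ve sum_ord2 (lorentzC x) ex (lorentzC n) en; ring.
- by rewrite vx !ex xx (lorentzC n) xn; ring.
- by rewrite vn !en xn nn; ring.
Qed.

End LorentzProduct.

(** * Spacelike immersions into the light cone *)

Section Immersion.
Context {R : realType} (U : set 'rV[R]_2) (X : 'rV[R]_2 -> 'rV[R]_4).
Hypothesis oU : open U.
Hypothesis sX : smooth_on U X.
Hypothesis Xnull : forall z, U z -> lorentz (X z) (X z) = 0.
Hypothesis gG : riemannian_on U (induced_metric X).
Hypothesis gH : riemannian_on U (II_eta X).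
#[local] Opaque partial christoffel christoffel1.
#[local] Opaque gauss_curvature riemann difference_tensor.
Implicit Types (u z : 'rV[R]_2) (i j k l : 'I_2).

Local Notation g := (induced_metric X).
Local Notation h := (II_eta X).
Local Notation "'d1 i" := (partial i X) (at level 10, i at next level).
Local Notation "'d2 i j" := (partial i (partial j X))
  (at level 10, i at next level, j at next level).

Let dX z : U z -> differentiable X z.
Proof. exact: smooth_differentiable sX. Qed.

Let dX1 z i : U z -> differentiable ('d1 i) z.
Proof. exact: smooth_differentiable (smooth_partial i sX). Qed.

Let dX2 z i j : U z -> differentiable ('d2 i j) z.
Proof. exact: smooth_differentiable (smooth_partial i (smooth_partial j sX)). Qed.

Lemma induced_metricE z i j : g z i j = lorentz ('d1 i z) ('d1 j z).
Proof. by rewrite mxE. Qed.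

(** [eta] is chosen to be zero when no vector has the required properties; then
    [II_eta] would vanish and could not be positive definite. *)
Lemma eta_spec z : U z ->
  [/\ is_normal X z (eta X z), lorentz (eta X z) (eta X z) = 0
    & lorentz (X z) (eta X z) = 1].
Proof.
move=> Uz; rewrite /eta; set P := [set a | _].
have [exP|noP] := pselect (exists a, P a); first exact: (xgetPex 0 exP).
have e0 : eta X z = 0.
  rewrite /eta -/P; by apply: xgetPN => a Pa; apply: noP; exists a.
have := riemannian_diag 0 gH Uz.
have -> : h z = 0; last by rewrite mxE ltxx.
rewrite /II_eta /weingarten e0 (_ : \matrix_(i, j) _ = 0) ?mul0mx ?oppr0 //.
by apply/matrixP => i j; rewrite !mxE lorentzC lorentz0l.
Qed.

Lemma eta_normal z i : U z -> lorentz ('d1 i z) (eta X z) = 0.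
Proof. by case/eta_spec. Qed.

Lemma eta_null z : U z -> lorentz (eta X z) (eta X z) = 0.
Proof. by case/eta_spec. Qed.

Lemma eta_position z : U z -> lorentz (X z) (eta X z) = 1.
Proof. by case/eta_spec. Qed.

Lemma II_etaE z i j : U z -> h z i j = - lorentz ('d2 i j z) (eta X z).
Proof.
move=> Uz; rewrite /II_eta /weingarten mulmxKV ?(riemannian_unit gG) // !mxE.
rewrite /second_form lorentzDl lorentzNl; congr (- _).
suff -> : lorentz (tangential X z ('d2 i j z)) (eta X z) = 0 by rewrite subr0.
rewrite /tangential lorentz_suml big1 // => k _; rewrite lorentz_suml big1 // => l _.
by rewrite lorentzZl eta_normal // mulr0.
Qed.

Lemma position_normal z i : U z -> lorentz ('d1 i z) (X z) = 0.
Proof.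
move=> Uz; have := lorentz_partial i (dX Uz) (dX Uz).
rewrite (partial_eq_on (U := U) (g := fun=> 0 : R) i oU Xnull Uz) partial_cst.
rewrite (lorentzC (X z)); lra.
Qed.

Lemma second_position z i j : U z -> lorentz ('d2 i j z) (X z) = - g z i j.
Proof.
move=> Uz; have := lorentz_partial i (dX1 j Uz) (dX Uz).
rewrite (partial_eq_on (U := U) (g := fun=> 0 : R) i oU
  (fun y => @position_normal y j) Uz) partial_cst.
move=> e; apply/eqP; rewrite -addr_eq0; apply/eqP; rewrite [RHS]e.
rewrite induced_metricE.
exact (congr1 (+%R (lorentz ('d2 i j z) (X z))) (lorentzC ('d1 i z) ('d1 j z))).
Qed.

Lemma partialX_sym z i j : U z -> 'd2 i j z = 'd2 j i z.
Proof. exact: partialC_mx oU sX. Qed.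

Lemma second_tangent z i j l : U z ->
  lorentz ('d2 i j z) ('d1 l z) = christoffel1 g z i j l.
Proof.
move=> Uz.
have dg a b c : partial a (fun y => g y b c) z =
    lorentz ('d2 a b z) ('d1 c z) + lorentz ('d2 a c z) ('d1 b z).
  have gE : (fun y => g y b c) = fun y => lorentz ('d1 b y) ('d1 c y).
    by apply/funext => y; exact: induced_metricE.
  rewrite gE; apply: (etrans (lorentz_partial a (dX1 b Uz) (dX1 c Uz))).
  exact (congr1 (+%R (lorentz ('d2 a b z) ('d1 c z))) (lorentzC ('d1 b z) ('d2 a c z))).
apply: esym; apply: (@christoffel1_koszul _ _ _
  (fun a b c => lorentz ('d2 a b z) ('d1 c z)) dg _ i j l) => a b c.
exact (congr1 (lorentz^~ ('d1 c z)) (partialX_sym a b Uz)).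
Qed.

(** The normal plane is spanned by the null vectors [X] and [eta], with
    [<X,eta> = 1], so the coefficient on either one is the product with the other. *)
Lemma gauss_formula z i j : U z ->
  'd2 i j z =
  \sum_l christoffel g z l i j *: 'd1 l z - h z i j *: X z - g z i j *: eta X z.
Proof.
move=> Uz; apply: null_frame_decomposition.
- exact: riemannian_unit gG Uz.
- by move=> k; exact: position_normal.
- by move=> k; exact: eta_normal.
- exact: Xnull.
- exact: eta_null.
- exact: eta_position.
- move=> k; apply: (etrans (second_tangent i j k Uz)).
  apply: (etrans (esym (christoffel_lower i j k gG Uz))).
  by apply: eq_bigr => l _; congr (_ * _); exact: induced_metricE.
- exact: second_position.
- by rewrite II_etaE // opprK.
Qed.

#[local] Opaque induced_metric II_eta eta.

(** Since [eta] comes from a choice at each point, its regularity is read off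
    from [gauss_formula], which expresses [g_00 eta] through differentiable functions. *)
Lemma differentiable_eta z : U z -> differentiable (eta X) z.
Proof.
move=> Uz.
have dG a b : differentiable (fun y => g y a b) z := metric_differentiable a b oU gG Uz.
have dH a b : differentiable (fun y => h y a b) z := metric_differentiable a b oU gH Uz.
have dC l a b := differentiable_christoffel l a b oU gG Uz.
have g0 y (Uy : U y) := lt0r_neq0 (riemannian_diag 0 gG Uy).
have solve (q : R) (v a n : 'rV[R]_4) : q != 0 -> v = a - q *: n -> q^-1 *: (a - v) = n.
  by move=> q0 ->; rewrite opprB addrC subrK scalerA mulVf // scale1r.
apply: (differentiable_eq_on (U := U) (f := fun y => (g y 0 0)^-1 *:
  (\sum_l christoffel g y l 0 0 *: 'd1 l y - h y 0 0 *: X y - 'd2 0 0 y))) => //.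
  by move=> y Uy; exact: solve (g0 y Uy) (gauss_formula 0 0 Uy).
apply: differentiable_row => k.
have e (r p : R) (c : 'I_2 -> R) (a : 'I_2 -> 'rV[R]_4) (x v : 'rV[R]_4) :
    (r *: (\sum_l c l *: a l - p *: x - v)) 0 k =
    r * (c 0 * a 0 0 k + c 1 * a 1 0 k - p * x 0 k - v 0 k).
  by rewrite sum_ord2 !mxE.
rewrite (_ : (fun y => _) = fun y => (g y 0 0)^-1 * (christoffel g y 0 0 0 * 'd1 0 y 0 k
    + christoffel g y 1 0 0 * 'd1 1 y 0 k - h y 0 0 * X y 0 k - 'd2 0 0 y 0 k)); last first.
  by apply/funext => y; exact: e.
have d0 := differentiable_entry 0 k (dX Uz).
have d1 i := differentiable_entry 0 k (dX1 i Uz).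
have d2 := differentiable_entry 0 k (dX2 0 0 Uz).
apply: differentiableM; first by apply: differentiableV; [exact: dG | exact: g0].
apply: differentiableB; last exact: d2.
apply: differentiableB; last by apply: differentiableM; [exact: dH | exact: d0].
by apply: differentiableD; apply: differentiableM;
  [exact: dC | exact: d1 | exact: dC | exact: d1].
Qed.

Lemma position_eta_partial z k : U z -> lorentz (X z) (partial k (eta X) z) = 0.
Proof.
move=> Uz; have := lorentz_partial k (dX Uz) (differentiable_eta Uz).
rewrite (partial_eq_on (U := U) (g := fun=> 1 : R) k oU eta_position Uz) partial_cst.
by rewrite (eta_normal k Uz) add0r.
Qed.

Lemma eta_eta_partial z k : U z -> lorentz (eta X z) (partial k (eta X) z) = 0.
Proof.
move=> Uz; have := lorentz_partial k (differentiable_eta Uz) (differentiable_eta Uz).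
rewrite (partial_eq_on (U := U) (g := fun=> 0 : R) k oU eta_null Uz) partial_cst.
rewrite (lorentzC (partial _ _ _)); lra.
Qed.

Lemma tangent_eta_partial z k l : U z ->
  lorentz ('d1 l z) (partial k (eta X) z) = h z k l.
Proof.
move=> Uz; have := lorentz_partial k (dX1 l Uz) (differentiable_eta Uz).
rewrite (partial_eq_on (U := U) (g := fun=> 0 : R) k oU
  (fun y => @eta_normal y l) Uz) partial_cst.
rewrite (II_etaE k l Uz); lra.
Qed.

(** Differentiating [h_bc = - <X_bc, eta>] gives a third derivative of [X], which
    is symmetric in all indices, and [- <X_bc, eta_a>], whose value
    [- sum_l Gamma^l_bc h_la] is the term that completes the covariant derivative to a
    symmetric expression. *)
Lemma II_eta_codazzi : codazzi_on U g h.
Proof.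
move=> z i j k Uz.
have dh a b c : partial a (fun y => h y b c) z =
    - lorentz (partial a ('d2 b c) z) (eta X z)
    - \sum_l christoffel g z l b c * h z l a.
  rewrite (partial_eq_on (U := U) (g := fun y => - lorentz ('d2 b c y) (eta X y)) a oU
    (fun y => @II_etaE y b c) Uz).
  have de := differentiable_eta Uz.
  rewrite partialN; last exact: lorentz_differentiable (dX2 b c Uz) de.
  rewrite (lorentz_partial a (dX2 b c Uz) de) opprD; congr (_ - _).
  rewrite {1}(gauss_formula b c Uz) !sum_ord2 lorentz_combination.
  rewrite position_eta_partial // eta_eta_partial // !tangent_eta_partial //.
  rewrite !(riemannian_sym a _ gH Uz).
  by rewrite !mulr0 !subr0.
(* T stands for the third derivatives of X, paired with eta. *)
have generic (T : 'I_2 -> 'I_2 -> 'I_2 -> R) : (forall a b c, T a b c = T b a c) ->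
    (forall a b c, partial a (fun y => h y b c) z =
       - T a b c - \sum_l christoffel g z l b c * h z l a) ->
    covariant_derivative g h z k i j = covariant_derivative g h z i k j.
  move=> sT dT; rewrite /covariant_derivative (dT k i j) (dT i k j) (sT k i j) !sum_ord2.
  rewrite (christoffel_sym 0 k i oU gG Uz) (christoffel_sym 1 k i oU gG Uz).
  rewrite (riemannian_sym i 0 gH Uz) (riemannian_sym i 1 gH Uz).
  rewrite (riemannian_sym k 0 gH Uz) (riemannian_sym k 1 gH Uz).
  do ![move: (christoffel _ _ _ _ _) => ?].
  do ![move: (h z _ _) => ?].
  ring.
apply: generic dh => a b c.
exact (congr1 (lorentz^~ (eta X z)) (partialC_mx a b oU (smooth_partial c sX) Uz)).
Qed.

(** The first-kind Christoffel symbols are [<X_ij, X_l>], so the third derivatives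
    of [X] cancel in [riemann_lower] and leave [<X_00,X_11> - <X_01,X_01>]; its tangential
    part cancels against the quadratic terms, and its normal part is the right side. *)
Lemma gauss_equation z : U z ->
  gauss_curvature g z * \det (g z) =
  g z 1 1 * h z 0 0 - 2 * g z 0 1 * h z 0 1 + g z 0 0 * h z 1 1.
Proof.
move=> Uz; rewrite (gauss_curvatureE oU gG Uz) (riemann_lower 1 0 oU gG Uz).
have E i j k l : partial k (fun y => christoffel1 g y i j l) z =
    lorentz (partial k ('d2 i j) z) ('d1 l z) + lorentz ('d2 i j z) ('d2 k l z).
  rewrite (partial_eq_on (U := U) (g := fun y => lorentz ('d2 i j y) ('d1 l y)) k oU
    (fun y Uy => esym (second_tangent i j l Uy)) Uz).
  by rewrite (lorentz_partial k (dX2 i j Uz) (dX1 l Uz)).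
have F i j k l : lorentz ('d2 i j z) ('d2 k l z) =
    \sum_m christoffel g z m i j * christoffel1 g z k l m
    + h z i j * g z k l + g z i j * h z k l.
  rewrite {1}(gauss_formula i j Uz) !sum_ord2 lorentz_combination.
  have Xa a : lorentz ('d1 a z) ('d2 k l z) = christoffel1 g z k l a.
    by apply: etrans (second_tangent k l a Uz); exact: lorentzC.
  have XX : lorentz (X z) ('d2 k l z) = - g z k l.
    by apply: etrans (second_position k l Uz); exact: lorentzC.
  have Xe : lorentz (eta X z) ('d2 k l z) = - h z k l.
    by rewrite (II_etaE k l Uz) opprK; exact: lorentzC.
  by rewrite !Xa XX Xe !mulrN !opprK.
(* T and Q stand for the products <X_kij, X_l> and <X_ij, X_kl>. *)
have generic (T Q : 'I_2 -> 'I_2 -> 'I_2 -> 'I_2 -> R) : T 0 1 1 0 = T 1 0 1 0 ->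
    (forall i j k l, partial k (fun y => christoffel1 g y i j l) z = T k i j l + Q i j k l) ->
    (forall i j k l, Q i j k l = \sum_m christoffel g z m i j * christoffel1 g z k l m
      + h z i j * g z k l + g z i j * h z k l) ->
    partial 0 (fun y => christoffel1 g y 1 1 0) z
    - partial 1 (fun y => christoffel1 g y 0 1 0) z
    + \sum_l christoffel g z l 0 1 * christoffel1 g z 1 0 l
    - \sum_l christoffel g z l 1 1 * christoffel1 g z 0 0 l =
    g z 1 1 * h z 0 0 - 2 * g z 0 1 * h z 0 1 + g z 0 0 * h z 1 1.
  move=> sT dT QE; rewrite !dT !QE sT !sum_ord2.
  rewrite (riemannian_sym 1 0 gG Uz) (riemannian_sym 1 0 gH Uz).
  do ![move: (christoffel1 _ _ _ _ _) => ?].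
  do ![move: (christoffel _ _ _ _ _) => ?].
  do ![move: (h z _ _) => ?].
  do ![move: (g z _ _) => ?].
  ring.
apply: generic E F.
exact (congr1 (lorentz^~ ('d1 0 z)) (partialC_mx 0 1 oU (smooth_partial 1 sX) Uz)).
Qed.

End Immersion.

(** * Proof of the theorem *)

Theorem theorem3p1 (R : realType) (M : smooth_surface R) (psi : M -> 'rV[R]_4)
    (psi_immersion : spacelike_immersion psi)
    (psi_lightcone : forall p, future_lightcone (psi p))
    (psi_II_eta : II_eta_riemannian psi)
    (p : M) (c : chart R M) (c_atlas : atlas c) (c_p : cdom c p)
    (w : 'I_2 -> 'rV[R]_2) :
  let X := local_expr psi c in
  let u := coords c p in
  let g := induced_metric X in
  let h := II_eta X in
  let d := fun z => \det (weingarten X z) in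
  orthonormal_frame (h u) w ->
  2 * gauss_curvature h u =
    gauss_curvature g u ^+ 2 / d u
    + \sum_i \sum_j bilin (h u) (difference_tensor h g u (w i) (w j))
                                (difference_tensor h g u (w i) (w j))
    - (4 * d u ^+ 2)^-1 * bilin (h u) (gradient h d u) (gradient h d u).
Proof.
move=> X u g h d ow.
have oU : open (cimg c) := @cimg_open _ _ c; have Uu : cimg c u := coords_img c_p.
have [sX _ gG] := psi_immersion c c_atlas; have gH := psi_II_eta c c_atlas.
have Xnull z : cimg c z -> lorentz (X z) (X z) = 0.
  by move=> _; case: (psi_lightcone (param c z)).
have cod := II_eta_codazzi oU sX Xnull gG gH.
(* The Weingarten matrix is - h g^-1, and signs disappear in a 2 x 2 determinant. *)
pose d' z := \det (h z) / \det (g z).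
have dE z : cimg c z -> d z = d' z.
  move=> Uz; have uG := riemannian_unit gG Uz.
  have -> : d z = \det (- h z *m invmx (g z)).
    by rewrite /d /h /II_eta opprK mulmxK.
  by rewrite det_mulmx det_inv /d' !det2 !mxE; congr (_ / _); ring.
have gradE : gradient h d u = gradient h d' u.
  rewrite /gradient; congr (_ *m _); apply/matrixP => a i; rewrite !mxE.
  exact: (partial_eq_on (U := cimg c)) Uu.
(* By the Gauss equation the h-trace of g is K / d. *)
have tr := trace_frame (riemannian_sym 1 0 gG Uu) (riemannian_sym 1 0 gH Uu) ow.
rewrite -(gauss_equation oU sX Xnull gG gH Uu) in tr.
have G0 := lt0r_neq0 (riemannian_det gG Uu).
have H0 := lt0r_neq0 (riemannian_det gH Uu).
rewrite (codazzi_pair_curvature oU gG gH cod Uu ow) gradE (dE u Uu) -/d'.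
congr (_ + _ - _); rewrite expr2 -mulrA; congr (_ * _).
by apply: (mulIf H0); rewrite tr /d'; field; rewrite G0 H0.
Qed.
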